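(* There exists an infinite family of pairwise non-commensurable semi-arithmetic Fuchsian groups, all with the same coarea and the same arithmetic dimension, but with unbounded stretch (i.e. the set of stretches $\delta(\Gamma)$ of groups $\Gamma$ in the family is unbounded).
   Context: A Fuchsian group is a discrete subgroup $\Gamma < \mathrm{PSL}(2,\mathbb{R})$, acting on the hyperbolic plane $\mathbb{H}$ by Möbius transformations; its coarea is the hyperbolic area of $\Gamma\backslash\mathbb{H}$. Two Fuchsian groups $\Gamma_1,\Gamma_2$ are commensurable if for some $g\in\mathrm{PSL}(2,\mathbb{R})$ the group $\Gamma_1\cap g\Gamma_2g^{-1}$ has finite index in both $\Gamma_1$ and $g\Gamma_2g^{-1}$. Let $\Gamma^{(2)} = \langle \gamma^2 \mid \gamma\in\Gamma\rangle$. The invariant trace field of $\Gamma$ is $k\Gamma = \mathbb{Q}(\mathrm{tr}\,\Gamma^{(2)})$ (traces of matrix lifts). $\Gamma$ is semi-arithmetic if it has finite coarea, $k\Gamma$ is a totally real number field, and the traces of all elements of $\Gamma$ are algebraic integers. The arithmetic dimension $\mathrm{a.dim}(\Gamma)$ is the number of field embeddings $\sigma: k\Gamma\hookrightarrow\mathbb{R}$ (including the identity inclusion) for which $\sigma(\mathrm{tr}\,\Gamma^{(2)})$ is unbounded. The invariant quaternion algebra $A\Gamma\subset \mathrm{M}(2,\mathbb{R})$ consists of the finite sums $\sum a_i\gamma_i$ with $a_i\in k\Gamma$ and $\gamma_i$ matrix lifts of elements of $\Gamma^{(2)}$; it is a quaternion algebra over $k\Gamma$. The number of embeddings of $k\Gamma$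 into $\mathbb{R}$ over which $A\Gamma$ splits (i.e. over which it becomes isomorphic to $\mathrm{M}(2,\mathbb{R})$) equals $r=\mathrm{a.dim}(\Gamma)$. Let these be $\sigma_1=\mathrm{id},\sigma_2,\dots,\sigma_r$. Let $\rho_1:A\Gamma\to\mathrm{M}(2,\mathbb{R})$ be the inclusion and for $i\ge 2$ let $\rho_i: A\Gamma\to \mathrm{M}(2,\mathbb{R})$ be a ring embedding extending $\sigma_i$ (it is unique up to conjugation in $\mathrm{GL}(2,\mathbb{R})$). Then $\rho=(\rho_1,\dots,\rho_r)$ induces a discrete representation $\rho_0:\Gamma^{(2)}\to \mathrm{PSL}(2,\mathbb{R})^r$, and $\mathrm{PSL}(2,\mathbb{R})^r$ acts componentwise on $\mathbb{H}^r$. Equip $\mathbb{H}^r$ with the Kobayashi metric, i.e. the maximum of the hyperbolic distances in the $r$ factors. $\Gamma$ has stretch at most $L$ if, for some such $\rho_0$, there exists a $K$-Lipschitz map $u:\mathbb{H}\to\mathbb{H}^r$ with $K\le L$ that is $\rho_0$-equivariant: $u(\gamma z)=\rho_0(\gamma)u(z)$ for all $\gamma\in\Gamma^{(2)}$, $z\in\mathbb{H}$. The stretch $\delta(\Gamma)$ is the infimum of all such $L$. *)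

(* Defs.v *)
From HB Require Import structures.
From mathcomp Require Import all_boot all_order all_algebra.
From mathcomp Require Import complex.
From mathcomp Require Import all_classical all_reals all_analysis.
Import Order.TTheory GRing.Theory Num.Theory numFieldNormedType.Exports.

Set Implicit Arguments.
Unset Strict Implicit.
Unset Printing Implicit Defensive.

Local Open Scope complex_scope.
Local Open Scope classical_set_scope.
Local Open Scope ring_scope.

(* A subset of PSL(2,R) is represented throughout by its full preimage in
   SL(2,R), that is by a set of matrices of determinant 1 stable under
   negation.  Subgroups of PSL(2,R) thus correspond bijectively to the
   subgroups of SL(2,R) containing -1; this correspondence preserves
   discreteness, intersections, conjugation and indices. *)

Section HyperbolicPlane.
Context {R : realType}.
Implicit Types (g : 'M[R]_2) (z w : R[i]).

Definition upper_half_plane : set R[i] := [set z | 0 < complex.Im z].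

Definition mobius g z : R[i] :=
  ((g 0 0)%:C * z + (g 0 1)%:C) / ((g 1 0)%:C * z + (g 1 1)%:C).

(* arcosh t = ln (t + sqrt (t ^ 2 - 1)), and
   cosh d(z, w) = 1 + |z - w|^2 / (2 Im z Im w) *)
Definition arcosh (t : R) : R := ln (t + Num.sqrt (t ^+ 2 - 1)).

Definition hyp_dist z w : R :=
  arcosh (1 + ((complex.Re z - complex.Re w) ^+ 2 +
               (complex.Im z - complex.Im w) ^+ 2) /
              (2 * complex.Im z * complex.Im w)).

Definition kobayashi_dist n (z w : 'I_n -> R[i]) : R :=
  \big[Num.max/0]_(i < n) hyp_dist (z i) (w i).

Definition cartesian (D : set R[i]) :
    set (measurableTypeR R * measurableTypeR R) :=
  [set p | D (p.1 +i* p.2)].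

Definition hyp_area (D : set R[i]) : \bar R :=
  (\int[(lebesgue_measure \x lebesgue_measure)]_(p in cartesian D)
     ((p.2 ^+ 2)^-1)%:E)%E.

End HyperbolicPlane.

Section FuchsianGroups.
Context {R : realType}.
Implicit Types (G H : set 'M[R]_2) (g : 'M[R]_2).

Definition psl2_subgroup G : Prop :=
  [/\ G `<=` [set g | \det g = 1], G 1, G (- 1),
      (forall g h, G g -> G h -> G (g * h)) &
      (forall g, G g -> G g^-1)].

Definition fuchsian G : Prop := psl2_subgroup G /\ G `<=` isolated G.

(* The translates of D cover the half-plane and overlap in null sets only; 1 and
   - 1 are the matrices acting trivially.  The area of D is then the hyperbolic
   area of the quotient and does not depend on D. *)
Definition fundamental_domain G (D : set R[i]) : Prop :=
  [/\ D `<=` upper_half_plane,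
      measurable (cartesian D),
      (forall z, upper_half_plane z -> exists2 g, G g & D (mobius g z)) &
      (forall g, G g -> g <> 1 -> g <> - 1 ->
         hyp_area (D `&` (mobius g @` D)) = 0%E)].

Definition has_coarea G (a : \bar R) : Prop :=
  exists2 D, fundamental_domain G D & hyp_area D = a.

Definition finite_index H G : Prop :=
  H `<=` G /\ finite_set [set [set g * h | h in H] | g in G].

Definition conjugate g G : set 'M[R]_2 := [set g * h * g^-1 | h in G].

Definition commensurable G1 G2 : Prop :=
  exists g, [/\ \det g = 1,
    finite_index (G1 `&` conjugate g G2) G1 &
    finite_index (G1 `&` conjugate g G2) (conjugate g G2)].

(* the preimage in SL(2,R) of the subgroup generated by the squares *)
Definition squares_subgroup G : set 'M[R]_2 :=
  smallest psl2_subgroup [set g ^+ 2 | g in G].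

End FuchsianGroups.

Section InvariantTraceField.
Context {R : realType}.
Variable G : set 'M[R]_2.

Definition trace_set : set R := [set \tr g | g in squares_subgroup G].

(* the smallest subfield of R containing the traces *)
Definition trace_field : {pred R} :=
  mem (smallest (fun K : set R => divring_closed (mem K)) trace_set).

Lemma trace_field_divring_closed : divring_closed trace_field.
Proof.
split; first by apply/mem_set => K [[]/set_mem].
- move=> x y /set_mem Kx /set_mem Ky; apply/mem_set => K KG.
  by case: (KG) => -[_ Ksub _] _; apply/set_mem/Ksub; apply/mem_set;
    [exact: Kx | exact: Ky].
- move=> x y /set_mem Kx /set_mem Ky; apply/mem_set => K KG.
  by case: (KG) => -[_ _ Kdiv] _; apply/set_mem/Kdiv; apply/mem_set;
    [exact: Kx | exact: Ky].
Qed.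

HB.instance Definition _ :=
  GRing.isDivringClosed.Build R trace_field trace_field_divring_closed.

Definition inv_trace_field := {x : R | x \in trace_field}.

HB.instance Definition _ := [isSub of inv_trace_field for @sval _ _].
HB.instance Definition _ := [Choice of inv_trace_field by <:].
HB.instance Definition _ :=
  [SubChoice_isSubIntegralDomain of inv_trace_field by <:].
HB.instance Definition _ :=
  [SubIntegralDomain_isSubField of inv_trace_field by <:].

(* the finite sums of a_i *: g_i, with a_i in the field and g_i a lift of an
   element of the squares subgroup *)
Definition quat_algebra : {pred 'M[R]_2} :=
  mem [set x : 'M[R]_2 | exists2 s : seq (inv_trace_field * 'M[R]_2),
         (forall p, p \in s -> squares_subgroup G p.2)
         & x = \sum_(p <- s) val p.1 *: p.2].

Lemma quat_algebra_subring_closed : subring_closed quat_algebra.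
Proof.
split.
- apply/mem_set; exists [:: (1, 1)]; last by rewrite big_seq1 scale1r.
  by move=> p /[!inE] /eqP -> /=; move=> K [[]].
- move=> x y /set_mem[s sG ->] /set_mem[t tG ->]; apply/mem_set.
  exists (s ++ [seq (- p.1, p.2) | p <- t]).
    by move=> p; rewrite mem_cat => /orP[/sG//|/mapP[q /tG qG ->]].
  rewrite big_cat big_map -sumrN; congr (_ + _).
  by apply: eq_bigr => p _; rewrite rmorphN scaleNr.
- move=> x y /set_mem[s sG ->] /set_mem[t tG ->]; apply/mem_set.
  exists [seq (p.1 * q.1, p.2 * q.2) | p <- s, q <- t].
    move=> _ /allpairsP[[p q] [/= /sG pG /tG qG ->]] /= K KG.
    by case: (KG) => -[_ _ _ Kmul _] _; apply: Kmul; [exact: pG | exact: qG].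
  rewrite big_allpairs_dep mulr_suml; apply: eq_bigr => p _.
  rewrite mulr_sumr; apply: eq_bigr => q _.
  by rewrite rmorphM -scalerAl -scalerAr scalerA.
Qed.

HB.instance Definition _ :=
  GRing.isSubringClosed.Build 'M[R]_2 quat_algebra quat_algebra_subring_closed.

Definition inv_quat_algebra := {x : 'M[R]_2 | x \in quat_algebra}.

HB.instance Definition _ := [isSub of inv_quat_algebra for @sval _ _].
HB.instance Definition _ := [Choice of inv_quat_algebra by <:].
HB.instance Definition _ := [SubChoice_isSubNzRing of inv_quat_algebra by <:].

End InvariantTraceField.

Section SemiArithmetic.
Context {R : realType}.
Implicit Types G : set 'M[R]_2.

Definition number_field (K : fieldType) : Prop :=
  [pchar K] =i pred0 /\
  exists (n : nat) (e : 'I_n -> K), forall x : K,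
    exists c : 'I_n -> rat, x = \sum_(i < n) ratr (c i) * e i.

Definition totally_real (K : fieldType) : Prop :=
  forall f : {rmorphism K -> R[i]}, forall x, complex.Im (f x) = 0.

Definition semi_arithmetic G : Prop :=
  [/\ fuchsian G,
      (exists a : R, has_coarea G a%:E),
      number_field (inv_trace_field G),
      totally_real (inv_trace_field G) &
      forall g, G g -> integralOver (intr : int -> R) (\tr g)].

Definition unbounded_embedding G (f : {rmorphism inv_trace_field G -> R}) :=
  ~ bounded_set (f @` [set t | trace_set G (val t)]).

Definition has_arith_dim G (n : nat) : Prop :=
  ([set f : {rmorphism inv_trace_field G -> R} | unbounded_embedding f]
    #= `I_n)%card.

Definition extends G (f : {rmorphism inv_trace_field G -> R})
    (rho : {rmorphism inv_quat_algebra G -> 'M[R]_2}) : Prop :=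
  forall (a : inv_trace_field G) (x : inv_quat_algebra G),
    val x = (val a)%:M -> rho x = (f a)%:M.

(* An isomorphism of R-algebras from the base change of the quaternion algebra
   along f to M(2,R) amounts to a ring morphism rho extending f that maps a
   basis of the quaternion algebra over the invariant trace field to a basis
   of M(2,R) over R. *)
Definition splits_over G (f : {rmorphism inv_trace_field G -> R}) : Prop :=
  exists rho : {rmorphism inv_quat_algebra G -> 'M[R]_2}, extends f rho /\
  exists (n : nat) (e : 'I_n -> inv_quat_algebra G),
    (forall x : inv_quat_algebra G,
       exists! c : {ffun 'I_n -> inv_trace_field G},
         val x = \sum_(i < n) val (c i) *: val (e i)) /\
    (forall x : 'M[R]_2,
       exists! c : {ffun 'I_n -> R}, x = \sum_(i < n) c i *: rho (e i)).

(* f enumerates the embeddings over which the quaternion algebra splits, with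
   f ord0 the inclusion, and rho is the tuple of ring embeddings rho_i. *)
Definition split_system G (n : nat)
    (f : 'I_n.+1 -> {rmorphism inv_trace_field G -> R})
    (rho : 'I_n.+1 -> {rmorphism inv_quat_algebra G -> 'M[R]_2}) : Prop :=
  [/\ injective f, range f = @splits_over G,
      f ord0 =1 val, rho ord0 =1 val &
      forall i, injective (rho i) /\ extends (f i) (rho i)].

Definition equivariant G (n : nat)
    (rho : 'I_n.+1 -> {rmorphism inv_quat_algebra G -> 'M[R]_2})
    (u : R[i] -> 'I_n.+1 -> R[i]) : Prop :=
  forall x : inv_quat_algebra G, squares_subgroup G (val x) ->
  forall z, upper_half_plane z ->
  forall i, u (mobius (val x) z) i = mobius (rho i x) (u z i).

Definition lipschitz_map (n : nat) (K : R) (u : R[i] -> 'I_n -> R[i]) : Prop :=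
  (forall z, upper_half_plane z -> forall i, upper_half_plane (u z i)) /\
  forall z w, upper_half_plane z -> upper_half_plane w ->
    kobayashi_dist (u z) (u w) <= K * hyp_dist z w.

Definition has_stretch_at_most G (L : R) : Prop :=
  exists (n : nat) (f : 'I_n.+1 -> {rmorphism inv_trace_field G -> R})
    (rho : 'I_n.+1 -> {rmorphism inv_quat_algebra G -> 'M[R]_2})
    (K : R) (u : R[i] -> 'I_n.+1 -> R[i]),
  [/\ split_system f rho, K <= L, lipschitz_map K u & equivariant rho u].

(* +oo when no equivariant Lipschitz map exists *)
Definition stretch G : \bar R :=
  ereal_inf [set L%:E | L in [set L | has_stretch_at_most G L]].

End SemiArithmetic.

(* Main.v *)
Require Import Defs.
From HB Require Import structures.
From mathcomp Require Import all_boot all_order all_algebra.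
From mathcomp Require Import complex.
From mathcomp Require Import all_classical all_reals all_analysis.
From mathcomp Require Import measurable_realfun ring lra zify.
Import Order.TTheory GRing.Theory Num.Theory numFieldNormedType.Exports.

Set Implicit Arguments.
Unset Strict Implicit.
Unset Printing Implicit Defensive.

Local Open Scope classical_set_scope.
Local Open Scope ring_scope.

(* Let u > 1 be a unit of norm 1 in a real quadratic field, and tile the real line
   periodically by intervals of lengths 2u and 2.  The half-turns about the tops of
   the semicircles over these intervals, together with the translation by 2(u + 1)
   that preserves the tiling, generate a discrete group with two cusps; a strip above
   two consecutive semicircles is a fundamental domain, made of two ideal triangles,
   whatever u is.  All entries lie in Z[u], so the traces are algebraic integers; the
   invariant trace field is Q(u) and the quaternion algebra is M(2, Q(u)), so that both
   real embeddings split it, and a pair of parabolics makes the traces unbounded under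
   both: the arithmetic dimension is 2.  The translation times the half-turn about the
   long tile has trace 2(1 + 1/u), whose conjugate 2(1 + u) is larger.  Hence no power
   of it has a rational trace, and two such groups over distinct fields are not
   commensurable.  As u grows, its square moves a suitable point by a bounded distance
   while its conjugate has unbounded translation length, so the Lipschitz constant of an
   equivariant map is at least a constant times ln u.  Distinct fields come from the
   roots of x^2 - (p - 2) x + 1, with p prime. *)

(** The half-turn about the top of a semicircle of center c and radius r has entries c/r, -(c^2 +
    r^2)/r and 1/r, so units as radii keep the entries integral: hence the radii u and 1. Changing
    their ratio deforms the group within one topological type, a sphere with two cusps and two cone
    points of order 2, so the area stays fixed while the field varies. As the norm of u is 1, the
    second embedding replaces u by 1/u in every formula; a trace that stays bounded as u grows may
    thus have an unbounded conjugate. An equivariant map turns the displacement of a point under an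
    element into a displacement under its conjugate, which is at least the translation length of the
    conjugate wherever the map lands; this is what bounds Lipschitz constants from below without
    constructing any map. The ring embeddings being given abstractly, only the trace and determinant
    of the conjugate matrix are available, and they suffice. The square is taken because the
    representation is defined on the subgroup generated by squares. *)

Section Matrix2.
Context {R : comNzRingType}.
Implicit Types (a b c d : R) (A B : 'M[R]_2).

Definition mx2 a b c d : 'M[R]_2 :=
  \matrix_(i, j) if i == 0 then if j == 0 then a else b
                 else if j == 0 then c else d.

Lemma mx2E a b c d :
  ((mx2 a b c d 0 0 = a) * (mx2 a b c d 0 1 = b) *
   (mx2 a b c d 1 0 = c) * (mx2 a b c d 1 1 = d))%type.
Proof. by rewrite !mxE. Qed.

Lemma mx2P A B :
  A 0 0 = B 0 0 -> A 0 1 = B 0 1 -> A 1 0 = B 1 0 -> A 1 1 = B 1 1 -> A = B.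
Proof.
move=> h00 h01 h10 h11; apply/matrixP => i j.
have ord2 (k : 'I_2) : k = 0 \/ k = 1.
  by case: k => -[|[|//]] p; [left|right]; exact/val_inj.
by case: (ord2 i) (ord2 j) => -> [] ->.
Qed.

Lemma oppmx2 a b c d : - mx2 a b c d = mx2 (- a) (- b) (- c) (- d).
Proof. by apply: mx2P; rewrite !mxE. Qed.

Lemma mulmx2 A B : A * B = mx2
  (A 0 0 * B 0 0 + A 0 1 * B 1 0) (A 0 0 * B 0 1 + A 0 1 * B 1 1)
  (A 1 0 * B 0 0 + A 1 1 * B 1 0) (A 1 0 * B 0 1 + A 1 1 * B 1 1).
Proof.
have l01 : lift ord0 ord0 = 1 :> 'I_2 by exact/val_inj.
by apply: mx2P; rewrite mx2E !mxE !big_ord_recl big_ord0 addr0 l01.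
Qed.

Lemma one_mx2 : 1 = mx2 1 0 0 1.
Proof. by apply: mx2P; rewrite mx2E !mxE. Qed.

Lemma det_mx2E A : \det A = A 0 0 * A 1 1 - A 0 1 * A 1 0.
Proof.
rewrite (expand_det_row A 0) !big_ord_recl big_ord0 addr0 /cofactor !det_mx11 !mxE.
rewrite /= expr0 expr1 mul1r mulN1r mulrN.
have -> : lift 0 0 = 1 :> 'I_2 by exact/val_inj.
by have -> : lift 1 0 = 0 :> 'I_2 by exact/val_inj.
Qed.

Lemma tr_mx2E A : \tr A = A 0 0 + A 1 1.
Proof.
rewrite /mxtrace !big_ord_recl big_ord0 addr0.
by congr (_ + A _ _); exact/val_inj.
Qed.

End Matrix2.

Section Matrix2Field.
Context {R : fieldType}.
Implicit Types A B : 'M[R]_2.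

Lemma inv_mx2 A : \det A = 1 -> A^-1 = mx2 (A 1 1) (- A 0 1) (- A 1 0) (A 0 0).
Proof.
move=> dA; have uA : A \is a GRing.unit by rewrite unitmxE dA unitr1.
apply: (mulrI uA); rewrite divrr//.
move: dA; rewrite det_mx2E mulmx2 one_mx2 => dA.
by apply: mx2P; rewrite !mx2E//; [rewrite mulrN dA|ring|ring|rewrite -dA; ring].
Qed.

Lemma det_mx2M A B : \det (A * B) = \det A * \det B.
Proof. by rewrite -det_mulmx. Qed.

Lemma detN_mx2 A : \det (- A) = \det A.
Proof. by rewrite !det_mx2E !mxE; ring. Qed.

(** Cayley-Hamilton. It governs the traces of powers and the effect of ring embeddings on traces. *)
Lemma sqr_mx2 A : A ^+ 2 = \tr A *: A - (\det A)%:M.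
Proof.
rewrite expr2 tr_mx2E det_mx2E mulmx2.
by apply: mx2P; rewrite !mx2E !mxE ?mulr1n ?mulr0n /=; ring.
Qed.

End Matrix2Field.

(** * Möbius action in real coordinates *)

Section Mobius.
Context {R : realType}.
Implicit Types (g h : 'M[R]_2) (z w : R[i]).
Notation Re := complex.Re.
Notation Im := complex.Im.
Local Open Scope complex_scope.

(** The squared modulus of c z + d, by which the action divides imaginary parts. *)
Definition mobius_den g z : R :=
  (g 1 0 * Re z + g 1 1) ^+ 2 + (g 1 0 * Im z) ^+ 2.

Lemma mobius_den_gt0 g z : \det g = 1 -> 0 < Im z -> 0 < mobius_den g z.
Proof.
rewrite det_mx2E /mobius_den => dg z0.
have [c0|c0] := eqVneq (g 1 0) 0.
  move: dg; rewrite c0 mulr0 subr0 !mul0r add0r expr0n addr0 => dg.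
  rewrite exprn_even_gt0//=; apply/eqP => d0.
  by move: dg; rewrite d0 mulr0 => /eqP; rewrite eq_sym oner_eq0.
apply: ltr_wpDl; first exact: sqr_ge0.
by rewrite exprn_even_gt0//= mulf_neq0// gt_eqF.
Qed.

Lemma mobius_reim g z : \det g = 1 -> 0 < Im z ->
  mobius g z =
  (((g 0 0 * Re z + g 0 1) * (g 1 0 * Re z + g 1 1) +
     g 0 0 * g 1 0 * Im z ^+ 2) / mobius_den g z) +i* (Im z / mobius_den g z).
Proof.
move=> dg z0; have := mobius_den_gt0 dg z0.
move: dg; rewrite det_mx2E /mobius /mobius_den.
case: z z0 => x y /= y0; move: (g 0 0) (g 0 1) (g 1 0) (g 1 1) => a b c d dg n0.
have n0' := lt0r_neq0 n0.
have D0 : c%:C * (x +i* y) + d%:C != 0.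
  apply/eqP => /eqP; rewrite eq_complex /= !(mul0r, subr0, addr0) => /andP[/eqP e1 /eqP e2].
  by move: n0; rewrite e1 e2 !expr0n addr0 ltxx.
apply: (mulIf D0); rewrite divfK//.
apply/eqP; rewrite eq_complex /= !(mul0r, subr0, addr0); rewrite -[y / _]mul1r -dg.
by apply/andP; split; apply/eqP; field.
Qed.

Lemma Im_mobius g z : \det g = 1 -> 0 < Im z ->
  Im (mobius g z) = Im z / mobius_den g z.
Proof. by move=> dg z0; rewrite mobius_reim. Qed.

Lemma mobius_upper g z : \det g = 1 ->
  upper_half_plane z -> upper_half_plane (mobius g z).
Proof.
by move=> dg z0; rewrite /upper_half_plane/= Im_mobius// divr_gt0// mobius_den_gt0.
Qed.

Lemma mobiusM g h z : \det g = 1 -> \det h = 1 -> 0 < Im z ->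
  mobius (g * h) z = mobius g (mobius h z).
Proof.
move=> dg dh z0; have hz0 := mobius_upper dh z0.
have dgh : \det (g * h) = 1 by rewrite det_mx2M dg dh mulr1.
have neq0 (k : 'M[R]_2) w : \det k = 1 -> 0 < Im w ->
    (k 1 0)%:C * w + (k 1 1)%:C != 0.
  move=> dk w0; have := mobius_den_gt0 dk w0; rewrite /mobius_den.
  case: w w0 => x y /= y0 n0; apply/eqP => /eqP.
  rewrite eq_complex /= !(mul0r, subr0, addr0) => /andP[/eqP e1 /eqP e2].
  by move: n0; rewrite e1 e2 !expr0n addr0 ltxx.
have := neq0 _ _ dg hz0; have := neq0 _ _ dh z0.
rewrite /mobius mulmx2 !mx2E !rmorphD !rmorphM /=.
move: (g 0 0)%:C (g 0 1)%:C (g 1 0)%:C (g 1 1)%:C (h 0 0)%:C (h 0 1)%:C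
  (h 1 0)%:C (h 1 1)%:C => a b c d a' b' c' d' n1 n2.
pose w := (a' * z + b') / (c' * z + d').
have e p q : (p * a' + q * c') * z + (p * b' + q * d') = (p * w + q) * (c' * z + d').
  by rewrite /w; field.
by rewrite !e -mulf_div divff// mulr1.
Qed.

Lemma mobius1 z : mobius 1 z = z.
Proof. by rewrite /mobius one_mx2 !mx2E mul1r mul0r add0r addr0 divr1. Qed.

Lemma mobiusN g z : mobius (- g) z = mobius g z.
Proof.
by rewrite /mobius !mxE !rmorphN !mulNr -!opprD invrN mulrNN.
Qed.

End Mobius.

Section Squares.
Context {R : realDomainType}.
Implicit Types x y : R.

Lemma ler_sqr2 x y : 0 <= x -> x <= y -> x ^+ 2 <= y ^+ 2.
Proof. by move=> x0 xy; rewrite ler_pXn2r ?nnegrE// (le_trans x0). Qed.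

Lemma ltr_sqr2 x y : 0 <= x -> x < y -> x ^+ 2 < y ^+ 2.
Proof. by move=> x0 xy; rewrite ltr_pXn2r ?nnegrE// (le_trans x0)// ltW. Qed.

Lemma ler_of_sqr2 x y : 0 <= y -> x ^+ 2 <= y ^+ 2 -> `|x| <= y.
Proof.
by move=> y0; rewrite -(real_normK (num_real x)) ler_pXn2r ?nnegrE.
Qed.

Lemma ltr_of_sqr2 x y : 0 <= y -> x ^+ 2 < y ^+ 2 -> `|x| < y.
Proof.
by move=> y0; rewrite -(real_normK (num_real x)) ltr_pXn2r ?nnegrE.
Qed.

End Squares.

(** * Half-turns about a tiling of the real line *)

Section Tiling.
Context {R : realType}.
Variable u : R.
Hypothesis u1 : 1 <= u.
Implicit Types (k l n : int) (z w : R[i]) (g h : 'M[R]_2) (c r t : R).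
Notation Re := complex.Re.
Notation Im := complex.Im.

(* The intervals of center (center k) and radius (radius k) tile the line. *)
Definition center k : R := k%:~R * (u + 1).
Definition radius k : R := if odd (absz k) then 1 else u.

Lemma radius_gt0 k : 0 < radius k.
Proof. by rewrite /radius; case: ifP => _ //; apply: lt_le_trans u1. Qed.

Lemma radius_le k : radius k <= u.
Proof. by rewrite /radius; case: ifP. Qed.

Lemma radius_shift k n : radius (k + 2 * n) = radius k.
Proof.
rewrite /radius; suff -> : odd (absz (k + 2 * n)) = odd (absz k) by [].
by clear u1; lia.
Qed.

Lemma center_shift k n : center (k + 2 * n) = center k + n%:~R * (2 * (u + 1)).
Proof. by rewrite /center intrD intrM; ring. Qed.

(** Distinct tiles of equal parity have centers at distance at least 2(u + 1); for opposite parities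
    the radii add up to u + 1. *)
Lemma tangent k l : k != l -> radius k + radius l <= `|center k - center l|.
Proof.
move=> kl; rewrite /center -mulrBl normrM -intrB -intr_norm.
rewrite (@ger0_norm _ (u + 1)); last by have := u1; lra.
have [kpar|kpar] := eqVneq (odd (absz k)) (odd (absz l)).
  have h2 : (2 : int) <= `|k - l| by lia.
  have : (2 : R) <= `|k - l|%:~R by rewrite (ler_int R 2).
  by rewrite /radius kpar; have := u1; case: ifP => _ ? ?; nra.
have h1 : (1 : int) <= `|k - l| by lia.
have : (1 : R) <= `|k - l|%:~R by rewrite (ler_int R 1).
have -> : radius k + radius l = u + 1.
  by rewrite /radius; move: kpar; case: (odd (absz k)) (odd (absz l)) => -[]//= _; rewrite addrC.
by have := u1; nra.
Qed.

Definition sqdist k z : R := (Re z - center k) ^+ 2 + Im z ^+ 2.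

(* The half-turn about c + ir, which preserves the circle |z - c| = r. *)
Definition rotation c r : 'M[R]_2 :=
  mx2 (c / r) (- (c ^+ 2 + r ^+ 2) / r) r^-1 (- c / r).

Definition translation t : 'M[R]_2 := mx2 1 t 0 1.

Definition half_turn k : 'M[R]_2 := rotation (center k) (radius k).

Definition shift n : 'M[R]_2 := translation (n%:~R * (2 * (u + 1))).

Lemma det_half_turn k : \det (half_turn k) = 1.
Proof.
have r0 := lt0r_neq0 (radius_gt0 k).
by rewrite det_mx2E !mx2E; field.
Qed.

Lemma det_shift n : \det (shift n) = 1.
Proof. by rewrite det_mx2E !mx2E; ring. Qed.

Lemma sqr_half_turn k : half_turn k * half_turn k = -1.
Proof.
have r0 := lt0r_neq0 (radius_gt0 k).
by rewrite mulmx2 one_mx2 oppmx2; apply: mx2P; rewrite !mx2E; field.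
Qed.

Lemma inv_half_turn k : (half_turn k)^-1 = - half_turn k.
Proof.
rewrite inv_mx2 ?det_half_turn// !mx2E.
by rewrite oppmx2; apply: mx2P; rewrite !mx2E ?mulNr ?opprK.
Qed.

Lemma inv_shift n : (shift n)^-1 = shift (- n).
Proof.
rewrite inv_mx2 ?det_shift// !mx2E.
by apply: mx2P; rewrite !mx2E //= ?oppr0// mulrNz mulNr.
Qed.

Lemma shift0 : shift 0 = 1.
Proof. by rewrite /shift mul0r one_mx2. Qed.

Lemma shiftM n n' : shift n * shift n' = shift (n + n').
Proof.
rewrite mulmx2; apply: mx2P; rewrite !mx2E ?intrD; ring.
Qed.

(** Translations permute the tiles, so those in a word can all be pushed to its right end. *)
Lemma shift_half_turn n k : shift n * half_turn k = half_turn (k + 2 * n) * shift n.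
Proof.
have r0 := lt0r_neq0 (radius_gt0 k).
rewrite /half_turn center_shift radius_shift.
rewrite !mulmx2; apply: mx2P; rewrite !mx2E; field => //.
Qed.

Lemma mobius_shift n z :
  mobius (shift n) z = ((Re z + n%:~R * (2 * (u + 1))) +i* Im z)%C.
Proof.
case: z => x y; rewrite /mobius !mx2E mul0r add0r divr1 mul1r.
by apply/eqP; rewrite eq_complex /= addr0 !eqxx.
Qed.

Lemma sqdist_gt0 k z : 0 < Im z -> 0 < sqdist k z.
Proof. by move=> z0; rewrite ltr_wpDl ?sqr_ge0// exprn_gt0. Qed.

Lemma mobius_half_turn k z : 0 < Im z -> mobius (half_turn k) z =
  ((center k - radius k ^+ 2 * (Re z - center k) / sqdist k z) +i*
   (radius k ^+ 2 * Im z / sqdist k z))%C.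
Proof.
move=> z0; have r0 := lt0r_neq0 (radius_gt0 k).
have n0 := lt0r_neq0 (sqdist_gt0 k z0).
rewrite mobius_reim ?det_half_turn//.
have -> : mobius_den (half_turn k) z = sqdist k z / radius k ^+ 2.
  by rewrite /mobius_den !mx2E /sqdist; field.
rewrite !mx2E; move: n0; rewrite /sqdist => n0.
by apply/eqP; rewrite eq_complex /=; apply/andP; split; apply/eqP; field; rewrite n0 r0.
Qed.

Lemma Im_shift n z : Im (mobius (shift n) z) = Im z.
Proof. by rewrite mobius_shift. Qed.

Lemma sqdist_shift k n z :
  sqdist k (mobius (shift n) z) = sqdist (k - 2 * n) z.
Proof.
rewrite mobius_shift /sqdist /=.
have -> : k - 2 * n = k + 2 * (- n) by ring.
by rewrite center_shift mulrNz; congr (_ + _); ring.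
Qed.

(** The half-turn is z -> c - r^2/(z - c): it inverts the distance to the center, and so swaps the
    inside and the outside of the half-disc. *)
Lemma sqdist_half_turn k z : 0 < Im z ->
  sqdist k (mobius (half_turn k) z) = radius k ^+ 4 / sqdist k z.
Proof.
move=> z0; have n0 := lt0r_neq0 (sqdist_gt0 k z0).
rewrite mobius_half_turn// {1}/sqdist /=.
by move: n0; rewrite /sqdist => n0; field.
Qed.

(* A point of the closed half-disc over one tile projects strictly inside that tile. *)
Lemma sqdist_separated k l z : 0 < Im z -> k != l ->
  sqdist l z <= radius l ^+ 2 -> radius k ^+ 2 < sqdist k z.
Proof.
move=> z0 /tangent kl; have rk := radius_gt0 k; have rl := radius_gt0 l.
rewrite /sqdist => lz.
have lx : `|Re z - center l| < radius l.
  apply: ltr_of_sqr2; first exact: ltW.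
  by apply: lt_le_trans lz; rewrite ltrDl exprn_gt0.
have kx : radius k < `|Re z - center k|.
  have := ler_distD (Re z) (center k) (center l).
  by rewrite (distrC (center k) (Re z)); lra.
apply: (@lt_trans _ _ (`|Re z - center k| ^+ 2)).
  by apply: ltr_sqr2 => //; exact: ltW.
by rewrite real_normK ?num_real// ltrDl exprn_gt0.
Qed.

(** Words of half-turns without equal neighbours, ended by one translation, up to sign since the
    group lives in SL(2). The index is the leading tile, which is all that cancellation and
    ping-pong look at. *)
Inductive reduced : int -> 'M[R]_2 -> Prop :=
| ReducedShift k n (b : bool) :
    reduced k (half_turn k * ((-1) ^+ b *: shift n))
| ReducedTurn k l g : k != l -> reduced l g -> reduced k (half_turn k * g).

Definition normal_form g :=
  (exists n (b : bool), g = (-1) ^+ b *: shift n) \/ (exists k, reduced k g).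

Lemma reduced_opp k g : reduced k g -> reduced k (- g).
Proof.
elim=> {k g} [k n b|k l g kl _ IH].
  rewrite -mulrN -scaleNr.
  by have := ReducedShift k n (~~ b); rewrite signrN.
by rewrite -mulrN; apply: ReducedTurn kl IH.
Qed.

Lemma reduced_det k g : reduced k g -> \det g = 1.
Proof.
elim=> {k g} [k n b|k l g kl _ IH]; last by rewrite det_mx2M IH det_half_turn mulr1.
rewrite det_mx2M det_half_turn mul1r det_mx2E !mxE.
by case: b; rewrite /= ?expr1 ?expr0; ring.
Qed.

Lemma normal_form_opp g : normal_form g -> normal_form (- g).
Proof.
move=> [[n [b ->]]|[k gk]]; last by right; exists k; exact: reduced_opp.
by left; exists n, (~~ b); rewrite signrN scaleNr.
Qed.

Lemma reduced_shift n k g : reduced k g -> reduced (k + 2 * n) (shift n * g).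
Proof.
elim=> {k g} [k n' b|k l g kl _ IH]; rewrite mulrA shift_half_turn -mulrA.
  by rewrite -scalerAr shiftM; exact: ReducedShift.
by apply: ReducedTurn IH; rewrite (inj_eq (addIr _)).
Qed.

Lemma normal_form_shift n g : normal_form g -> normal_form (shift n * g).
Proof.
move=> [[n' [b ->]]|[k gk]]; last by right; exists (k + 2 * n); exact: reduced_shift.
by left; exists (n + n'), b; rewrite -scalerAr shiftM.
Qed.

Lemma normal_form_half_turn k g : normal_form g -> normal_form (half_turn k * g).
Proof.
move=> [[n [b ->]]|[l gl]]; first by right; exists k; exact: ReducedShift.
have [kl|kl] := eqVneq k l; last by right; exists k; exact: ReducedTurn gl.
(* Two equal half-turns multiply to -1 and expose the rest of the word. *)
case: gl kl => {l g} [l n b|l l' g _ gl'] ->; rewrite mulrA sqr_half_turn mulN1r.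
  by apply: normal_form_opp; left; exists n, b.
by apply: normal_form_opp; right; exists l'.
Qed.

Definition tiling_group : set 'M[R]_2 :=
  smallest psl2_subgroup [set shift 1; half_turn 0; half_turn 1].

Lemma smallest_psl2_subgroup (S : set 'M[R]_2) : S `<=` [set g | \det g = 1] ->
  psl2_subgroup (smallest psl2_subgroup S).
Proof.
move=> S1; have SL : psl2_subgroup [set g : 'M[R]_2 | \det g = 1].
  split=> //=.
  - by rewrite det1.
  - by rewrite detN_mx2 det1.
  - by move=> g h g1 h1; rewrite det_mx2M g1 h1 mulr1.
  - move=> g g1; have ug : g \is a GRing.unit by rewrite unitmxE g1 unitr1.
    by rewrite -[LHS]mul1r -g1 -det_mx2M divrr// det1.
split.
- by move=> g; apply; split.
- by move=> K [[]].
- by move=> K [[]].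
- by move=> g h Gg Gh K KS; case: (KS) => -[_ _ _ KM _] _; apply: KM; [exact: Gg|exact: Gh].
- by move=> g Gg K KS; case: (KS) => -[_ _ _ _ KV] _; apply: KV; exact: Gg.
Qed.

Lemma tiling_group_psl2 : psl2_subgroup tiling_group.
Proof.
apply: smallest_psl2_subgroup => g [[]|] -> /=;
  [exact: det_shift|exact: det_half_turn|exact: det_half_turn].
Qed.

Lemma tiling_group_gen : [/\ tiling_group (shift 1), tiling_group (half_turn 0) &
  tiling_group (half_turn 1)].
Proof. by split=> K [_]; apply; [left; left|left; right|right]. Qed.

Lemma tiling_group_shift n : tiling_group (shift n).
Proof.
have [_ G1 _ GM GV] := tiling_group_psl2; have [Gs _ _] := tiling_group_gen.
have Gnat (m : nat) : tiling_group (shift m).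
  elim: m => [|m IH]; first by rewrite shift0.
  by rewrite intS -shiftM; exact: GM.
case: n => m; first exact: Gnat.
by rewrite NegzE -inv_shift; exact: GV.
Qed.

Lemma tiling_group_half_turn k : tiling_group (half_turn k).
Proof.
have [_ G1 _ GM GV] := tiling_group_psl2; have [_ G0 G1'] := tiling_group_gen.
have [b [n kE]] : exists (b : bool) (n : int), k = b%:Z + 2 * n.
  exists (odd (absz k)), (divz k 2).
  lia.
have -> : half_turn k = shift n * half_turn b%:Z * shift (- n).
  by rewrite shift_half_turn -mulrA shiftM subrr shift0 mulr1 kE.
apply: (GM) (tiling_group_shift _); apply: (GM); first exact: tiling_group_shift.
by case: b {kE}.
Qed.

Lemma tiling_group_normal_form g : tiling_group g -> normal_form g.
Proof.
(* Left multiplication by these matrices preserves normal forms; asking the same of the inverse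
   makes them a subgroup. *)
pose S : set 'M[R]_2 := [set g | [/\ \det g = 1,
  forall h, normal_form h -> normal_form (g * h) &
  forall h, normal_form h -> normal_form (g^-1 * h)]].
have detN1 : \det (-1 : 'M[R]_2) = 1.
  by rewrite detN_mx2 det1.
have unitN a : \det a = 1 -> (a : 'M[R]_2) \is a GRing.unit.
  by move=> a1; rewrite unitmxE a1 unitr1.
have PS : psl2_subgroup S.
  split.
  - by move=> ? [].
  - by split; rewrite ?det1// => h; rewrite ?invr1 mul1r.
  - by split; rewrite // => h nh; rewrite ?invrN1 mulN1r; exact: normal_form_opp.
  - move=> a b [a1 aS aV] [b1 bS bV]; split.
    + by rewrite det_mx2M a1 b1 mulr1.
    + by move=> h nh; rewrite -mulrA; apply: aS; exact: bS.
    + by move=> h nh; rewrite invrM ?unitN// -mulrA; apply: bV; exact: aV.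
  - move=> a [a1 aS aV]; split; rewrite ?invrK//.
    by rewrite -[LHS]mul1r -a1 -det_mx2M divrr ?det1// unitN.
have turnS k : S (half_turn k).
  split; [exact: det_half_turn|by move=> h; exact: normal_form_half_turn|].
  move=> h nh; rewrite inv_half_turn mulNr; apply: normal_form_opp.
  exact: normal_form_half_turn.
move=> Gg; suff [_ gS _] : S g.
  by rewrite -[g]mulr1; apply: gS; left; exists 0, false; rewrite shift0 expr0 scale1r.
apply: Gg; split=> // _ [[]|] ->//.
split; first exact: det_shift.
  by move=> h; exact: normal_form_shift.
by move=> h; rewrite inv_shift; exact: normal_form_shift.
Qed.

End Tiling.

(** * Ping-pong and the fundamental domain *)

Section FundamentalDomain.
Context {R : realType}.
Variable u : R.
Hypothesis u1 : 1 <= u.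
Implicit Types (k l n : int) (z w : R[i]) (g h : 'M[R]_2).
Notation Re := complex.Re.
Notation Im := complex.Im.
Local Notation center := (center u).
Local Notation radius := (radius u).
Local Notation sqdist := (sqdist u).
Local Notation shift := (shift u).
Local Notation half_turn := (half_turn u).
Local Notation reduced := (reduced u).
Local Notation normal_form := (normal_form u).
Local Notation G := (tiling_group u).

Definition outside z := forall k, radius k ^+ 2 <= sqdist k z.

Lemma mobius_sign (b : bool) g z : mobius ((-1) ^+ b *: g) z = mobius g z.
Proof. by case: b; rewrite ?expr1 ?expr0 ?scaleN1r ?scale1r ?mobiusN. Qed.

Lemma det_sign (b : bool) n : \det ((-1) ^+ b *: shift n) = 1.
Proof. by case: b; rewrite ?expr1 ?expr0 ?scaleN1r ?scale1r ?detN_mx2 det_shift. Qed.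

Lemma outside_shift n z : outside z -> outside (mobius (shift n) z).
Proof.
move=> oz k; rewrite sqdist_shift.
have -> : k - 2 * n = k + 2 * (- n) by ring.
by rewrite -(radius_shift u k (- n)); exact: oz.
Qed.

Lemma half_turn_inside k z : 0 < Im z -> radius k ^+ 2 <= sqdist k z ->
  sqdist k (mobius (half_turn k) z) <= radius k ^+ 2.
Proof.
move=> z0 kz; rewrite sqdist_half_turn// ler_pdivrMr ?sqdist_gt0//.
by rewrite (exprD _ 2 2) ler_pM2l// exprn_gt0// radius_gt0.
Qed.

Lemma half_turn_inside_lt k z : 0 < Im z -> radius k ^+ 2 < sqdist k z ->
  sqdist k (mobius (half_turn k) z) < radius k ^+ 2.
Proof.
move=> z0 kz; rewrite sqdist_half_turn// ltr_pdivrMr ?sqdist_gt0//.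
by rewrite (exprD _ 2 2) ltr_pM2l// exprn_gt0// radius_gt0.
Qed.

(** Ping-pong: the tail of the word sends the point into the half-disc of another tile, hence
    strictly outside that of [k], and the leading half-turn brings it inside. *)
Lemma reduced_inside k g z : reduced k g -> 0 < Im z -> outside z ->
  sqdist k (mobius g z) <= radius k ^+ 2.
Proof.
move=> + z0 oz; elim=> {k g} [k n b|k l g kl lg IH].
  rewrite mobiusM ?det_half_turn ?det_sign// mobius_sign.
  by apply: half_turn_inside; [rewrite Im_shift|exact: outside_shift].
have dg := reduced_det u1 lg; have gz0 := mobius_upper dg z0.
rewrite mobiusM ?det_half_turn//; apply/ltW/half_turn_inside_lt => //.
exact: (sqdist_separated u1 gz0 kl).
Qed.

(** With at least two half-turns the inequality is strict, so only a single half-turn can leave a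
    point on an arc. *)
Lemma reduced_turn_inside k l g z : k != l -> reduced l g -> 0 < Im z -> outside z ->
  sqdist k (mobius (half_turn k * g) z) < radius k ^+ 2.
Proof.
move=> kl lg z0 oz; have dg := reduced_det u1 lg; have gz0 := mobius_upper dg z0.
rewrite mobiusM ?det_half_turn//; apply/half_turn_inside_lt => //.
by apply: (sqdist_separated u1 gz0 kl); exact: reduced_inside.
Qed.

(** The point 2ui lies outside all half-discs and is sent into one of radius at most u. Its height
    is at least halved, so |c z + d|^2 is at least 2 there; near the identity this number is close
    to 4 u^2 c^2 + 1. *)
Lemma normal_form_low g : normal_form g ->
  (exists n (b : bool), g = (-1) ^+ b *: shift n) \/
  2 <= 4 * u ^+ 2 * (g 1 0) ^+ 2 + (g 1 1) ^+ 2.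
Proof.
case=> [|[k gk]]; first by left.
right; have u0 : 0 < u by apply: lt_le_trans u1.
pose z : R[i] := (0 +i* (2 * u))%C.
have z0 : 0 < Im z by rewrite /= mulr_gt0.
have oz : outside z.
  move=> l; rewrite /sqdist /= ler_wpDl ?sqr_ge0//.
  apply: ler_sqr2; first by apply/ltW/radius_gt0.
  by have := radius_le u1 l; lra.
have := reduced_inside gk z0 oz.
have dg := reduced_det u1 gk; have := mobius_den_gt0 dg z0.
rewrite /sqdist Im_mobius//; set D := mobius_den _ _ => D0 kz.
have : (2 * u / D) ^+ 2 <= u ^+ 2.
  apply: (@le_trans _ _ (radius k ^+ 2)).
    by apply: le_trans kz; rewrite lerDr sqr_ge0.
  by apply: ler_sqr2 (radius_le u1 k); apply/ltW/radius_gt0.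
move=> /(ler_of_sqr2 (ltW u0)) /(le_trans (ler_norm _)); rewrite ler_pdivrMr//.
rewrite -[leRHS]mulrC ler_pM2r// => D2; apply: (le_trans D2).
by rewrite /D /mobius_den /=; lra.
Qed.

Lemma tiling_group_fuchsian : fuchsian G.
Proof.
have GP := tiling_group_psl2 u1; split => // g Gg.
have [GS G1 GN GM GV] := GP; split; first exact/mem_set.
have u0 : 0 < u by apply: lt_le_trans u1.
have dg : \det g = 1 := GS _ Gg.
pose s := 1 + `|g 0 0| + `|g 0 1| + `|g 1 0| + `|g 1 1|.
have s0 : 0 < s by rewrite /s -!addrA ltr_pwDl// !addr_ge0.
(* Chosen so that the entries of [g^-1 * h] are within 1/(8u) of those of the identity. *)
pose e := (8 * u * s)^-1.
have e0 : 0 < e by rewrite invr_gt0 !mulr_gt0.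
exists (ball g e); first exact: nbhsx_ballx.
apply/seteqP; split=> [h [/= gh Gh]|h ->]; last by split=> //; exact: ballxx.
have dh : \det h = 1 := GS _ Gh.
have ent i j : `|g i j - h i j| < e by case: gh => _ /(_ i j).
pose k := g^-1 * h.
have Gk : G k by apply: (GM) => //; exact: GV.
have kE : k = mx2 (g 1 1 * h 0 0 - g 0 1 * h 1 0) (g 1 1 * h 0 1 - g 0 1 * h 1 1)
   (g 0 0 * h 1 0 - g 1 0 * h 0 0) (g 0 0 * h 1 1 - g 1 0 * h 0 1).
  rewrite /k inv_mx2// mulmx2; apply: mx2P; rewrite !mx2E; ring.
have small (a b x y x' y' : R) : `|x - x'| < e -> `|y - y'| < e ->
    `|a| + `|b| <= s -> `|(a * x' - b * y') - (a * x - b * y)| <= (8 * u)^-1.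
  move=> xe ye ab.
  have -> : a * x' - b * y' - (a * x - b * y) = - (a * (x - x')) + b * (y - y') by ring.
  apply: (le_trans (ler_normD _ _)); rewrite normrN !normrM.
  apply: (@le_trans _ _ (`|a| * e + `|b| * e)).
    by apply: lerD; apply: ler_wpM2l => //; exact: ltW.
  rewrite -mulrDl; apply: (@le_trans _ _ (s * e)).
    by apply: ler_wpM2r => //; exact: ltW.
  rewrite le_eqVlt; apply/orP; left; apply/eqP; rewrite /e; field.
  by rewrite !lt0r_neq0.
have u8 : (8 * u)^-1 <= 8^-1 by rewrite lef_pV2 ?posrE ?mulr_gt0//; have := u1; lra.
have u8' : 8 * u * (8 * u)^-1 = 1 by rewrite divff// lt0r_neq0// mulr_gt0.
have n00 := normr_ge0 (g 0 0); have n01 := normr_ge0 (g 0 1).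
have n10 := normr_ge0 (g 1 0); have n11 := normr_ge0 (g 1 1).
move: dg; rewrite det_mx2E => dg.
have k00 : `|k 0 0 - 1| <= (8 * u)^-1.
  have -> : k 0 0 - 1 = (g 1 1 * h 0 0 - g 0 1 * h 1 0) -
      (g 1 1 * g 0 0 - g 0 1 * g 1 0) by rewrite kE mx2E -[X in _ - X]dg; ring.
  by apply: small; rewrite ?ent// /s; lra.
have k01 : `|k 0 1| <= (8 * u)^-1.
  have -> : k 0 1 = (g 1 1 * h 0 1 - g 0 1 * h 1 1) -
      (g 1 1 * g 0 1 - g 0 1 * g 1 1) by rewrite kE mx2E; ring.
  by apply: small; rewrite ?ent// /s; lra.
have k10 : `|k 1 0| <= (8 * u)^-1.
  have -> : k 1 0 = (g 0 0 * h 1 0 - g 1 0 * h 0 0) -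
      (g 0 0 * g 1 0 - g 1 0 * g 0 0) by rewrite kE mx2E; ring.
  by apply: small; rewrite ?ent// /s; lra.
have k11 : `|k 1 1 - 1| <= (8 * u)^-1.
  have -> : k 1 1 - 1 = (g 0 0 * h 1 1 - g 1 0 * h 0 1) -
      (g 0 0 * g 1 1 - g 1 0 * g 0 1) by rewrite kE mx2E -[X in _ - X]dg; ring.
  by apply: small; rewrite ?ent// /s; lra.
have [[n [b kn]]|] := normal_form_low (tiling_group_normal_form u1 Gk).
  suff k1 : k = 1.
    rewrite -[h]mul1r -(@divrr _ g) ?unitmxE ?det_mx2E ?dg ?unitr1//.
    by rewrite -mulrA -/k k1 mulr1.
  case: b kn; rewrite ?expr1 ?scaleN1r ?expr0 ?scale1r => kn.
    move: k00; rewrite kn !mxE /= => k00; exfalso.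
    have := le_trans k00 u8; rewrite ler_norml => /andP[]; lra.
  move: k01; rewrite kn mx2E => k01.
  have n0 : n = 0.
    apply/eqP/negPn/negP => n0.
    have : (1 : R) <= `|n|%:~R by rewrite (ler_int R 1); lia.
    move: (le_trans k01 u8); rewrite normrM -intr_norm (@ger0_norm _ (2 * _)); last by lra.
    by have := u1; nra.
  by rewrite n0 shift0.
(* Here 4 u^2 c^2 is at most 1/16 and d^2 at most (9/8)^2, too little for a sum of 2. *)
rewrite leNgt => /negP[].
have /ler_normlP[a1 a2] := k10; have /ler_normlP[] := le_trans k11 u8; move=> b1 b2.
have c1 : `|8 * u * k 1 0| <= 1.
  rewrite normrM (@ger0_norm _ (8 * u)) ?mulr_ge0 ?(ltW u0)//.
  by rewrite -[leRHS]u8' ler_wpM2l// mulr_ge0// ltW.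
have c2 : (8 * u * k 1 0) ^+ 2 <= 1.
  rewrite -(real_normK (num_real (8 * u * k 1 0))) -[leRHS](expr1n R 2).
  by apply: ler_sqr2 c1.
have d2 : (k 1 1) ^+ 2 <= (9 / 8) ^+ 2.
  have -> : (k 1 1) ^+ 2 = `|k 1 1| ^+ 2 by rewrite real_normK ?num_real.
  by apply: ler_sqr2 => //; rewrite ler_norml; apply/andP; split; lra.
by move: c2 d2; rewrite !exprMn => *; lra.
Qed.

(* The right halves of the two arcs are left out, so that the domain meets its
   translates in the two fixed points of the half-turns only. *)
Definition domain : set R[i] := [set z | [/\ 0 < Im z, - u <= Re z < u + 2 &
  forall k, k = 0 \/ k = 1 -> radius k ^+ 2 < sqdist k z \/
     (radius k ^+ 2 = sqdist k z /\ Re z <= center k)]].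

Lemma center0 : center 0 = 0. Proof. by rewrite /center mul0r. Qed.
Lemma center1 : center 1 = u + 1. Proof. by rewrite /center mul1r. Qed.
Lemma radius0 : radius 0 = u. Proof. by []. Qed.
Lemma radius1 : radius 1 = 1. Proof. by []. Qed.

Lemma lt_sqdist k z : 0 < Im z -> radius k <= `|Re z - center k| ->
  radius k ^+ 2 + Im z ^+ 2 <= sqdist k z.
Proof.
move=> z0 kz; rewrite lerD2r -[leRHS]real_normK ?num_real//.
by apply: ler_sqr2 => //; apply/ltW/radius_gt0.
Qed.

Lemma strip_far k z : - u <= Re z < u + 2 -> k != 0 -> k != 1 ->
  radius k <= `|Re z - center k|.
Proof.
move=> /andP[z1 z2] k0 k1; have rk := radius_gt0 u1 k; have [kneg|kpos] := ltrP k 0.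
  have := tangent u1 k0; rewrite center0 radius0 subr0 ltr0_norm; last first.
    rewrite /center pmulr_llt0; first by rewrite ltrz0.
    by have := u1; lra.
  by move=> h; rewrite ger0_norm; lra.
have kgt : 1 < k by lia.
have := tangent u1 k1; rewrite center1 radius1 ger0_norm; last first.
  have : (1 : R) <= k%:~R by rewrite (ler_int R 1) ltW.
  by rewrite /center; have := u1; nra.
by move=> h; rewrite ler0_norm; lra.
Qed.

Lemma domain_lt k z : domain z -> k != 0 -> k != 1 -> radius k ^+ 2 < sqdist k z.
Proof.
move=> [z0 zs _] k0 k1; apply: lt_le_trans (lt_sqdist z0 (strip_far zs k0 k1)).
by rewrite ltrDl exprn_gt0.
Qed.

Lemma domain_outside z : domain z -> outside z.
Proof.
move=> Dz k; case: (eqVneq k 0) => [->|k0].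
  by case: (Dz) => _ _ /(_ 0 (or_introl _ erefl))[/ltW|[->]].
case: (eqVneq k 1) => [->|k1]; last exact/ltW/domain_lt.
by case: (Dz) => _ _ /(_ 1 (or_intror _ erefl))[/ltW|[->]].
Qed.

Lemma strip_shift n (x y : R) : - u <= x < u + 2 -> - u <= y < u + 2 ->
  y = x + n%:~R * (2 * (u + 1)) -> n = 0.
Proof.
move=> /andP[x1 x2] /andP[y1 y2] yx; apply/eqP/negPn/negP => n0.
have [nneg|npos] := ltrP n 0.
  have : n%:~R <= (-1 : R) by rewrite (ler_int R n (-1)); lia.
  by have := u1; nra.
have : (1 : R) <= n%:~R by rewrite (ler_int R 1); lia.
by have := u1; nra.
Qed.

(** By ping-pong the image lies on an arc and the word has a single half-turn, which reflects that
    arc; both points being on its left half, they are its top. *)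
Lemma domain_overlap g z : G g -> g <> 1 -> g <> -1 ->
  domain z -> domain (mobius g z) ->
  mobius g z = (center 0 +i* radius 0)%C \/ mobius g z = (center 1 +i* radius 1)%C.
Proof.
move=> Gg g1 gN1 Dz Dw; have [z0 zs zc] := Dz; have [w0 ws wc] := Dw.
have oz := domain_outside Dz.
case: (tiling_group_normal_form u1 Gg) => [[n [b gE]]|[k gk]].
  exfalso; move: ws; rewrite gE mobius_sign mobius_shift /= => ws.
  have n0 := strip_shift zs ws erefl.
  by move: gE; rewrite n0 shift0; case: b; rewrite ?expr1 ?scaleN1r ?expr0 ?scale1r.
have win := reduced_inside gk z0 oz.
have k01 : k = 0 \/ k = 1.
  have [k0|k0] := eqVneq k 0; first by left.
  have [k1|k1] := eqVneq k 1; first by right.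
  by have := domain_lt Dw k0 k1; rewrite ltNge win.
case: (wc _ k01) => [|[kw wle]]; first by rewrite ltNge win.
suff wE : mobius g z = (center k +i* radius k)%C by case: k01 wE => ->; [left|right].
case: gk kw wle k01 w0 ws {Gg g1 gN1 win wc Dw} => {k} => [k n b|k l {}g kl lg] kw wle k01 w0 ws;
  last by have := reduced_turn_inside kl lg z0 oz; rewrite kw ltxx.
move: kw wle w0 ws.
rewrite mobiusM ?det_half_turn ?det_sign// mobius_sign.
set z' := mobius (shift n) z => kw wle w0 ws.
have z'0 : 0 < Im z' by rewrite Im_shift.
have r0 := radius_gt0 u1 k.
have kz' : sqdist k z' = radius k ^+ 2.
  move: kw; rewrite sqdist_half_turn// => kw.
  have := sqdist_gt0 u k z'0 => d0.
  apply: (@mulfI _ (radius k ^+ 2)); first by rewrite lt0r_neq0// exprn_gt0.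
  by rewrite {1}kw divfK ?lt0r_neq0// -exprD.
(* On its own circle a half-turn is the reflection in the vertical line through the center. *)
have Eh : mobius (half_turn k) z' = ((2 * center k - Re z') +i* Im z')%C.
  rewrite mobius_half_turn// kz'; apply/eqP; rewrite eq_complex /=.
  by apply/andP; split; apply/eqP; field; rewrite lt0r_neq0.
move: wle ws; rewrite Eh /= => wle ws.
have zr : `|Re z' - center k| < radius k.
  apply: ltr_of_sqr2; first exact: ltW.
  by rewrite -kz' ltrDl exprn_gt0.
have z's : - u <= Re z' < u + 2.
  move: zr; rewrite ltr_norml => /andP[]; case: k01 wle r0 => ->;
  by rewrite ?center0 ?center1 ?radius0 ?radius1; have := u1; move=> *; apply/andP; lra.
have n0 : n = 0.
  by apply: strip_shift zs z's _; rewrite /z' mobius_shift.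
have zz' : z' = z by rewrite /z' n0 shift0 mobius1.
have zle : Re z' <= center k.
  rewrite zz'; case: (zc _ k01) => [|[]//]; by rewrite -zz' kz' ltxx.
have zE : Re z' = center k by lra.
move: kz'; rewrite /sqdist zE subrr expr0n add0r => /eqP.
rewrite eqrXn2 ?ltW// => /eqP ->; congr (_ +i* _)%C; lra.
Qed.

Lemma tile_exists (x : R) : exists k, center k - radius k <= x < center k + radius k.
Proof.
pose n := Num.floor ((x + u) / (2 * (u + 1))).
have w0 : 0 < 2 * (u + 1) by have := u1; lra.
have := Num.Theory.floor_itv ((x + u) / (2 * (u + 1))).
rewrite -/n intrD ler_pdivlMr// ltr_pdivrMr// => /andP[n1 n2].
have e0 : center (2 * n) = n%:~R * (2 * (u + 1)).
  by rewrite -[2 * n]add0r center_shift center0 add0r.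
have e1 : center (1 + 2 * n) = u + 1 + n%:~R * (2 * (u + 1)).
  by rewrite center_shift center1.
have r0 : radius (2 * n) = u by rewrite -[2 * n]add0r radius_shift.
have r1 : radius (1 + 2 * n) = 1 by rewrite radius_shift.
have [xl|xl] := ltrP x (n%:~R * (2 * (u + 1)) + u).
  by exists (2 * n); rewrite e0 r0; apply/andP; lra.
by exists (1 + 2 * n); rewrite e1 r1; apply/andP; lra.
Qed.

(** Over its own tile a point avoids the other half-discs. A half-turn moves it from the right half
    of the arc to the left half if need be, and a translation brings the tile to 0 or 1. *)
Lemma domain_covered_outside k z : 0 < Im z ->
  center k - radius k <= Re z < center k + radius k ->
  radius k ^+ 2 <= sqdist k z -> exists2 g, G g & domain (mobius g z).
Proof.
move=> z0 zk kz; have [GS G1 GN GM GV] := tiling_group_psl2 u1.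
wlog zle : z z0 zk kz / radius k ^+ 2 < sqdist k z \/
    (radius k ^+ 2 = sqdist k z /\ Re z <= center k).
  move: kz; rewrite le_eqVlt => /orP[/eqP kz|kz] H; last first.
    by apply: H => //; [exact: ltW|left].
  have [zle|zle] := leP (Re z) (center k).
    by apply: H => //; [rewrite kz|right].
  have r0 := radius_gt0 u1 k.
  have zE : mobius (half_turn k) z = ((2 * center k - Re z) +i* Im z)%C.
    rewrite mobius_half_turn// -kz; apply/eqP; rewrite eq_complex /=.
    by apply/andP; split; apply/eqP; field; rewrite lt0r_neq0.
  have kz' : radius k ^+ 2 = sqdist k (mobius (half_turn k) z).
    by rewrite zE kz /sqdist /=; ring.
  have [||||g Gg gz] := H (mobius (half_turn k) z); rewrite -?kz' ?zE//=.
  - have : Re z - center k < radius k.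
      apply: (le_lt_trans (ler_norm _)).
      apply: ltr_of_sqr2; first exact: ltW.
      by rewrite kz ltrDl exprn_gt0.
    by move=> *; apply/andP; lra.
  - by right; split=> //; lra.
  exists (g * half_turn k); first by apply: (GM) => //; exact: tiling_group_half_turn.
  by rewrite mobiusM ?det_half_turn//; exact: GS.
have [b [n kE]] : exists (b : bool) (n : int), k = b%:Z + 2 * n.
  by exists (odd (absz k)), (divz k 2); lia.
exists (shift (- n)); first exact: tiling_group_shift.
have sd l : sqdist l (mobius (shift (- n)) z) = sqdist (l + 2 * n) z.
  by rewrite sqdist_shift; congr (sqdist _ _); ring.
have ck : center k = center b%:Z + n%:~R * (2 * (u + 1)) by rewrite kE center_shift.
have rk : radius k = radius b%:Z by rewrite kE radius_shift.
have zre : Re (mobius (shift (- n)) z) = Re z - n%:~R * (2 * (u + 1)).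
  by rewrite mobius_shift /= mulrNz mulNr.
split; rewrite ?Im_shift//.
  move: zk; rewrite zre ck rk => /andP[].
  by case: b {kE ck rk}; rewrite ?center0 ?center1 ?radius0 ?radius1; have := u1;
    move=> *; apply/andP; lra.
move=> l l01; rewrite sd zre; have [lb|lb] := eqVneq l b%:Z.
  rewrite lb -kE -rk; case: zle => [|[-> zle]]; [by left|right; split=> //].
  by move: zle; rewrite ck; lra.
left; rewrite -(radius_shift u l n); set m := l + 2 * n.
have km : m != k by rewrite /m kE (inj_eq (addIr _)).
apply: lt_le_trans (lt_sqdist z0 _); first by rewrite ltrDl exprn_gt0.
have := ler_distD (Re z) (center m) (center k).
rewrite (distrC (center m) (Re z)).
have : `|Re z - center k| <= radius k.
  by move: zk => /andP[? ?]; rewrite ler_norml; apply/andP; lra.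
by have := tangent u1 km; lra.
Qed.

(* A half-turn about a tile either brings a point of that half-disc back over the
   tile, hence outside all half-discs, or raises its height by a fixed amount. *)
Lemma domain_covers_rec (N : nat) (h : R) z : 0 < h -> h <= Im z ->
  u < Im z + N%:R * (h ^+ 3 / u ^+ 2) -> exists2 g, G g & domain (mobius g z).
Proof.
have [GS G1 GN GM GV] := tiling_group_psl2 u1.
have u0 : 0 < u by apply: lt_le_trans u1.
move=> h0; elim: N z => [|N IH] z hz hN; have z0 := lt_le_trans h0 hz;
  have [k zk] := tile_exists (Re z); have r0 := radius_gt0 u1 k.
  apply: (domain_covered_outside z0 zk).
  rewrite /sqdist ler_wpDl ?sqr_ge0//; apply: ler_sqr2; first exact: ltW.
  by apply/ltW; apply: le_lt_trans (radius_le u1 k) _; rewrite mul0r addr0 in hN.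
have [kz|kz] := leP (radius k ^+ 2) (sqdist k z).
  exact: (domain_covered_outside z0 zk).
have dk := det_half_turn u1 k.
have Gk : G (half_turn k) by exact: tiling_group_half_turn.
suff [g Gg gz] : exists2 g, G g & domain (mobius g (mobius (half_turn k) z)).
  exists (g * half_turn k); first exact: GM.
  by rewrite mobiusM//; exact: GS.
have s0 := sqdist_gt0 u k z0; have z'0 := mobius_upper dk z0.
have sE := sqdist_half_turn u1 k z0.
have : Im (mobius (half_turn k) z) = Im z * (radius k ^+ 2 / sqdist k z).
  by rewrite mobius_half_turn//=; field; rewrite lt0r_neq0.
set z' := mobius (half_turn k) z in sE z'0 *.
move=> ImE; have s'0 := sqdist_gt0 u k z'0.
have q1 : 1 < radius k ^+ 2 / sqdist k z by rewrite ltr_pdivlMr ?mul1r.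
have zz' : Im z <= Im z' by rewrite ImE ler_peMr// ltW.
have qE : radius k ^+ 2 / sqdist k z = sqdist k z' / radius k ^+ 2.
  by rewrite sE; field; rewrite !lt0r_neq0.
have [z'k|z'k] := boolP (center k - radius k <= Re z' < center k + radius k).
  apply: (domain_covered_outside z'0 z'k).
  have : 1 < sqdist k z' / radius k ^+ 2 by rewrite -qE.
  by rewrite ltr_pdivlMr ?exprn_gt0// mul1r => /ltW.
apply: IH; first exact: le_trans zz'.
apply: (lt_le_trans hN); rewrite -natr1 mulrDl mul1r addrCA [leRHS]addrC lerD2l.
have : radius k <= `|Re z' - center k|.
  rewrite leNgt; apply: contra z'k; rewrite ltr_norml => /andP[? ?].
  by apply/andP; lra.
move/(lt_sqdist z'0) => far.
(* Off the tile, [sqdist k z'] is at least the squared radius plus the squared height, so the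
   half-turn multiplies the height by 1 + h^2/u^2 or more, a gain of at least h^3/u^2. *)
have q2 : 1 + h ^+ 2 / u ^+ 2 <= sqdist k z' / radius k ^+ 2.
  rewrite ler_pdivlMr ?exprn_gt0//; apply: le_trans far.
  rewrite mulrDl mul1r lerD2l mulrAC -mulrA.
  apply: (@le_trans _ _ (h ^+ 2)).
    rewrite ler_piMr ?sqr_ge0// ler_pdivrMr ?exprn_gt0// mul1r.
    by apply: ler_sqr2; [exact: ltW|exact: radius_le].
  by apply: ler_sqr2; [exact: ltW|exact: le_trans zz'].
rewrite ImE qE; apply: (@le_trans _ _ (Im z * (1 + h ^+ 2 / u ^+ 2))); last first.
  by rewrite ler_wpM2l// ltW.
rewrite mulrDr mulr1 lerD2l exprS -mulrA ler_wpM2r//.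
by rewrite divr_ge0// ?sqr_ge0// exprn_ge0// ltW.
Qed.

Lemma domain_covers z : 0 < Im z -> exists2 g, G g & domain (mobius g z).
Proof.
have u0 : 0 < u by apply: lt_le_trans u1.
move=> z0; pose d := Im z ^+ 3 / u ^+ 2.
have d0 : 0 < d by rewrite divr_gt0// exprn_gt0.
apply: (@domain_covers_rec (Num.truncn (u / d)).+1 (Im z)) => //; rewrite -/d.
apply: (@lt_trans _ _ ((Num.truncn (u / d)).+1%:R * d)); last by rewrite ltrDr.
by rewrite -ltr_pdivrMr// truncnS_gt.
Qed.

End FundamentalDomain.

(** * Area *)

Section Area.
Context {R : realType}.
Local Notation mu := (@lebesgue_measure R).
Implicit Types c r t x : R.

Lemma measurable_fun_inv_ge0 d (T : measurableType d) (f : T -> R) :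
  measurable_fun [set: T] f -> (forall p, 0 <= f p) ->
  measurable_fun [set: T] (fun p => (f p)^-1).
Proof.
move=> mf f0.
rewrite (_ : (fun p => (f p)^-1) = (fun x => powR x (-1)) \o f); last first.
  by apply/funext => x /=; rewrite powR_inv1.
exact: (@measurableT_comp _ _ _ _ _ _ (@powR R ^~ (-1))).
Qed.

(** The flag [b] closes or opens the lower end: the domain contains the left half of each arc and
    not the right half. *)
Lemma integral_inv_sqr (b : bool) (s : R) : 0 < s ->
  (\int[mu]_(y in [set` Interval (BSide b s) +oo%O]) ((y ^+ 2)^-1)%:E = (s^-1)%:E)%E.
Proof.
move=> s0.
have minv : measurable_fun [set: R] (fun y : R => (y ^+ 2)^-1).
  by apply: measurable_fun_inv_ge0 => [|y]; [exact: measurable_funX|exact: sqr_ge0].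
have der (y : R) : 0 < y -> is_derive y 1 (fun y : R => - y^-1) ((y ^+ 2)^-1).
  move=> y0; have yn : y != 0 by rewrite gt_eqF.
  have := is_deriveN (@is_deriveV R id y 1 1 yn (is_derive_id _ _)).
  by rewrite scaler1 opprK.
have closed : (\int[mu]_(y in `[s, +oo[) ((y ^+ 2)^-1)%:E = (s^-1)%:E)%E.
  rewrite (@ge0_continuous_FTC2y _ _ (fun y => - y^-1) s 0) ?sub0e -?EFinN ?opprK//.
  - by move=> y _; rewrite invr_ge0 sqr_ge0.
  - apply: continuous_in_subspaceT => y; rewrite inE/= in_itv/= andbT => sy.
    have y0 : 0 < y by apply: lt_le_trans sy.
    by apply: cvgV; [rewrite lt0r_neq0// exprn_gt0|exact: exprn_continuous].
  - rewrite -oppr0; apply: cvgN.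
    by apply/gtr0_cvgV0; [exact: nbhs_pinfty_gt|exact: cvg_id].
  - by move=> y sy; have [] := der y (lt_trans s0 sy).
  - apply: cvg_at_right_filter; apply: cvgN; apply: cvgV; first by rewrite gt_eqF.
    exact: cvg_id.
  - move=> y; rewrite in_itv/= andbT => sy; rewrite derive1E.
    by have [_] := der y (lt_trans s0 sy).
case: b; first exact: closed.
rewrite integral_itv_obnd_cbnd//; apply/measurable_EFinP.
exact: measurable_funTS.
Qed.

Definition arc_density (c r x : R) : R := (Num.sqrt (r ^+ 2 - (x - c) ^+ 2))^-1.

Lemma measurable_arc c r : measurable_fun [set: R] (arc_density c r).
Proof.
apply: measurable_fun_inv_ge0 => [|x]; last exact: sqrtr_ge0.
apply: measurableT_comp.
  by apply: continuous_measurable_fun; exact: sqrt_continuous.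
apply: measurable_funB => //; apply: measurable_funX; exact: measurable_funB.
Qed.

Lemma arc_ge0 c r x : 0 <= arc_density c r x.
Proof. by rewrite invr_ge0 sqrtr_ge0. Qed.

Lemma is_derive_asin_affine (c r x : R) : 0 < r -> `|x - c| < r ->
  is_derive x 1 (fun x => asin ((x - c) / r)) (arc_density c r x).
Proof.
move=> r0 xr; have rn := lt0r_neq0 r0.
have yr : -1 < (x - c) / r < 1.
  by rewrite -ltr_norml normrM normfV (gtr0_norm r0) ltr_pdivrMr// mul1r.
have h1 : is_derive x 1 (fun x => (x - c) / r) (r^-1).
  rewrite (_ : (fun x => (x - c) / r) = r^-1 \*: (id - cst c)); last first.
    by apply/funext => y /=; rewrite mulrC.
  rewrite -[X in is_derive _ _ _ X]mulr1 -[X in _ * X]subr0.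
  by apply: is_deriveZ; apply: is_deriveB.
have := @is_derive1_comp _ (@asin R) (fun x => (x - c) / r) x _ _ (is_derive1_asin yr) h1.
suff -> : arc_density c r x = (Num.sqrt (1 - ((x - c) / r) ^+ 2))^-1 * r^-1 by [].
rewrite /arc_density -invfM; congr (_^-1).
rewrite -[X in _ * X](@ger0_norm _ r) ?ltW// -sqrtr_sqr -sqrtrM; last first.
  rewrite subr_ge0 -[leRHS](expr1n R 2) -real_normK ?num_real//.
  by apply: ler_sqr2 => //; rewrite ltW// ltr_norml.
by congr Num.sqrt; field.
Qed.

Lemma continuous_arc (c r x : R) : `|x - c| < r -> {for x, continuous (arc_density c r)}.
Proof.
move=> xr; have q0 : 0 < r ^+ 2 - (x - c) ^+ 2.
  by rewrite subr_gt0 -real_normK ?num_real//; apply: ltr_sqr2.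
apply: cvgV; first by rewrite gt_eqF// sqrtr_gt0.
apply: (@continuous_comp _ _ _ (fun x => r ^+ 2 - (x - c) ^+ 2) Num.sqrt); last first.
  exact: sqrt_continuous.
apply: cvgB; first exact: cvg_cst.
apply: (@continuous_comp _ _ _ (fun x => x - c) (fun x => x ^+ 2)).
  by apply: cvgB; [exact: cvg_id|exact: cvg_cst].
exact: exprn_continuous.
Qed.

(** The primitive is an arcsine, which has no derivative at the ends of the tile; hence t < 1. *)
Lemma integral_arc_segment c r t : 0 < r -> 0 < t < 1 ->
  (\int[mu]_(x in `[(c - r * t)%R, (c + r * t)%R]) (arc_density c r x)%:E =
   (asin t - asin (- t))%:E)%E.
Proof.
move=> r0 /andP[t0 t1]; have rn := lt0r_neq0 r0.
have rt0 : 0 < r * t by rewrite mulr_gt0.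
have rt1 : r * t < r by rewrite gtr_pMr.
have inr (x : R) : c - r * t <= x -> x <= c + r * t -> `|x - c| < r.
  by move=> *; rewrite ltr_norml; apply/andP; lra.
have der (x : R) : c - r * t <= x -> x <= c + r * t ->
    is_derive x 1 (fun x => asin ((x - c) / r)) (arc_density c r x).
  by move=> x1 x2; apply: is_derive_asin_affine => //; exact: inr.
have cont (x : R) : c - r * t <= x -> x <= c + r * t ->
    {for x, continuous (fun x => asin ((x - c) / r))}.
  move=> x1 x2; apply: differentiable_continuous; apply/derivable1_diffP.
  by have [] := der x x1 x2.
rewrite (@continuous_FTC2 _ _ (fun x => asin ((x - c) / r))).
- rewrite -EFinB; congr (_%:E); congr (asin _ - asin _); field => //.
- by lra.
- apply: continuous_in_subspaceT => x; rewrite inE/= in_itv/= => /andP[x1 x2].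
  by apply: continuous_arc; exact: inr.
- split.
  + by move=> x; rewrite in_itv/= => /andP[/ltW x1 /ltW x2]; have [] := der x x1 x2.
  + by apply: cvg_at_right_filter; apply: cont; lra.
  + by apply: cvg_at_left_filter; apply: cont; lra.
- move=> x; rewrite in_itv/= => /andP[/ltW x1 /ltW x2]; rewrite derive1E.
  by have [_] := der x x1 x2.
Qed.

Definition cutoff (n : nat) : R := 1 - n.+2%:R^-1.

(* Its value is pi, but only finiteness and independence of the triangle matter. *)
Definition ideal_triangle_area : \bar R :=
  limn (fun n => (asin (cutoff n) - asin (- cutoff n))%:E).

Lemma cutoff_itv n : 0 < cutoff n < 1.
Proof.
rewrite /cutoff; apply/andP; split; last by rewrite ltrBlDr ltrDl invr_gt0.
by rewrite subr_gt0 invf_lt1// ltr1n.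
Qed.

(** Monotone convergence along growing segments. The affine change of variable has already removed c
    and r from their integrals, so all tiles give the same area. *)
Lemma integral_arc c r : 0 < r ->
  (\int[mu]_(x in `](c - r)%R, (c + r)%R[) (arc_density c r x)%:E = ideal_triangle_area)%E.
Proof.
move=> r0; have rn := lt0r_neq0 r0.
pose F (n : nat) := [set` `[c - r * cutoff n, c + r * cutoff n]].
have FU : \bigcup_n F n = [set` `]c - r, c + r[].
  apply/seteqP; split=> [x [n _]|x]; rewrite /F /= !in_itv /=.
    move=> /andP[x1 x2]; have /andP[c1 c2] := cutoff_itv n.
    have : r * cutoff n < r by rewrite gtr_pMr.
    by move=> ?; apply/andP; lra.
  move=> /andP[x1 x2]; have xr : `|x - c| < r by rewrite ltr_norml; apply/andP; lra.
  (* The relative distance to the boundary: x is in [F n] as soon as 1/(n + 2) is at most [e]. *)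
  pose e := 1 - `|x - c| / r.
  have e0 : 0 < e by rewrite subr_gt0 ltr_pdivrMr// mul1r.
  exists (Num.truncn e^-1) => //=; rewrite in_itv/=.
  suff : `|x - c| <= r * cutoff (Num.truncn e^-1).
    by rewrite ler_norml => /andP[? ?]; apply/andP; lra.
  rewrite mulrC -ler_pdivrMr// /cutoff lerBrDl -lerBrDr -/e.
  rewrite invf_ple ?posrE// ltW// (lt_le_trans (truncnS_gt _))// ler_nat.
  by [].
rewrite -FU.
have Fint n : (\int[mu]_(x in F n) (arc_density c r x)%:E =
    (asin (cutoff n) - asin (- cutoff n))%:E)%E.
  exact: integral_arc_segment r0 (cutoff_itv n).
rewrite /ideal_triangle_area -(funext Fint); apply/esym/cvg_lim => //.
apply: ge0_nondecreasing_set_cvg_integral.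
- apply/nondecreasing_seqP => n; apply/subsetPset => x; rewrite /F /= !in_itv /=.
  have : cutoff n <= cutoff n.+1 by rewrite lerD2l lerN2 lef_pV2 ?posrE// ler_nat.
  by rewrite -(ler_pM2l r0) => ? /andP[? ?]; apply/andP; lra.
- by move=> n; exact: measurable_itv.
- by move=> n; apply/measurable_EFinP; apply: measurable_funTS; exact: measurable_arc.
- by move=> n x _; rewrite lee_fin arc_ge0.
Qed.

Lemma ideal_triangle_area_fin : ideal_triangle_area \is a fin_num.
Proof.
have E := @integral_arc 0 1 ltr01.
rewrite ge0_fin_numE; last first.
  by rewrite -E; apply: integral_ge0 => x _; rewrite lee_fin arc_ge0.
apply: (@le_lt_trans _ _ pi%:E); last exact: ltry.
apply: lime_le.
  apply: ereal_nondecreasing_is_cvgn; apply/nondecreasing_seqP => n.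
  rewrite -!(@integral_arc_segment 0 1) ?cutoff_itv//.
  apply: ge0_subset_integral => //.
  - by apply/measurable_EFinP; apply: measurable_funTS; exact: measurable_arc.
  - by move=> x _; rewrite lee_fin arc_ge0.
  - move=> x; rewrite /= !in_itv /=.
    have : cutoff n <= cutoff n.+1 by rewrite lerD2l lerN2 lef_pV2 ?posrE// ler_nat.
    by move=> ? /andP[? ?]; apply/andP; lra.
near=> n; rewrite lee_fin.
have /andP[c0 c1] := cutoff_itv n.
have h1 : asin (cutoff n) <= pi / 2 by apply: asin_lepi2; apply/andP; lra.
have h2 : - (pi / 2) <= asin (- cutoff n) by apply: asin_geNpi2; apply/andP; lra.
by lra.
Unshelve. all: by end_near. Qed.

End Area.

(** * Area of the fundamental domain *)

Section DomainArea.
Context {R : realType}.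
Variable u : R.
Hypothesis u1 : 1 <= u.
Implicit Types (k n : int) (z w : R[i]) (g h : 'M[R]_2) (x y : R).
Notation Re := complex.Re.
Notation Im := complex.Im.
Local Notation mu := (@lebesgue_measure R).
Local Notation center := (center u).
Local Notation radius := (radius u).
Local Notation sqdist := (sqdist u).
Local Notation domain := (domain u).
Local Notation G := (tiling_group u).

(** Boolean, so that measurability can be read off the connectives and vertical fibres become
    intervals. *)
Definition over k x y : bool :=
  (radius k ^+ 2 < (x - center k) ^+ 2 + y ^+ 2) ||
  ((radius k ^+ 2 == (x - center k) ^+ 2 + y ^+ 2) && (x <= center k)).

Lemma domainE x y : domain (x +i* y)%C <->
  [&& 0 < y, - u <= x, x < u + 2, over 0 x y & over 1 x y].
Proof.
split=> [[/= y0 /andP[x1 x2] xy]|/and5P[y0 x1 x2 o0 o1]].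
  apply/and5P; split=> //; apply/orP.
    by case: (xy 0 (or_introl erefl)) => [|[/eqP e c]]; [left|right; exact/andP].
  by case: (xy 1 (or_intror erefl)) => [|[/eqP e c]]; [left|right; exact/andP].
split=> /=; [by []|exact/andP|move=> k [] ->].
  by case/orP: o0 => [|/andP[/eqP e c]]; [left|right].
by case/orP: o1 => [|/andP[/eqP e c]]; [left|right].
Qed.

Lemma measurable_domain : measurable (cartesian domain).
Proof.
pose b (p : measurableTypeR R * measurableTypeR R) : bool :=
  [&& 0 < p.2, - u <= p.1, p.1 < u + 2, over 0 p.1 p.2 & over 1 p.1 p.2].
have -> : cartesian domain = [set: measurableTypeR R * measurableTypeR R] `&` b @^-1` [set true].
  by rewrite setTI; apply/seteqP; split=> p /domainE.
have m1 : measurable_fun [set: measurableTypeR R * measurableTypeR R]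
    (fun p : measurableTypeR R * measurableTypeR R => p.1 : R) := measurable_fst.
have m2 : measurable_fun [set: measurableTypeR R * measurableTypeR R]
    (fun p : measurableTypeR R * measurableTypeR R => p.2 : R) := measurable_snd.
have ms k : measurable_fun [set: measurableTypeR R * measurableTypeR R]
    (fun p : measurableTypeR R * measurableTypeR R =>
       (p.1 - center k) ^+ 2 + p.2 ^+ 2 : R).
  by apply: measurable_funD; apply: measurable_funX => //; exact: measurable_funB.
have mo k : measurable_fun [set: measurableTypeR R * measurableTypeR R]
    (fun p : measurableTypeR R * measurableTypeR R => over k p.1 p.2).
  apply: measurable_or; first exact: measurable_fun_ltr.
  by apply: measurable_and; [exact: measurable_fun_eqr|exact: measurable_fun_ler].
suff mb : measurable_fun [set: measurableTypeR R * measurableTypeR R] b.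
  by apply: mb => //.
apply: measurable_and; first exact: measurable_fun_ltr.
apply: measurable_and; first exact: measurable_fun_ler.
apply: measurable_and; first exact: measurable_fun_ltr.
by apply: measurable_and; exact: mo.
Qed.

Lemma domain_over k x y : k = 0 \/ k = 1 -> `|x - center k| < radius k ->
  domain (x +i* y)%C <-> (0 < y) && over k x y.
Proof.
move=> k01 xk; split=> [/domainE/and5P[y0 _ _ o0 o1]|/andP[y0 ok]].
  by rewrite y0; case: k01 => ->.
apply/domainE; apply/and5P.
have far l : 0 < y -> l = 0 \/ l = 1 -> l != k -> over l x y.
  move=> _ l01 lk; apply/orP; left.
  have lx : radius l <= `|x - center l|.
    have := tangent u1 lk; have := ler_distD x (center l) (center k).
    by rewrite (distrC (center l) x); lra.
  apply: (@le_lt_trans _ _ (`|x - center l| ^+ 2)).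
    by apply: ler_sqr2 lx; apply/ltW/radius_gt0.
  by rewrite real_normK ?num_real// ltrDl exprn_gt0.
move: xk; rewrite ltr_norml => /andP[x1 x2]; split=> //.
- by case: k01 x1 x2 => ->; rewrite ?center0 ?center1 ?radius0 ?radius1; have := u1; lra.
- by case: k01 x1 x2 => ->; rewrite ?center0 ?center1 ?radius0 ?radius1; have := u1; lra.
- have [<-//|k0] := eqVneq k 0; apply: far => //; [by left|by rewrite eq_sym].
- have [<-//|k0] := eqVneq k 1; apply: far => //; [by right|by rewrite eq_sym].
Qed.

(** The vertical fibre is a half-line that contains its lower end exactly over the left half of the
    tile. *)
Lemma over_itv k x y : `|x - center k| < radius k ->
  ((0 < y) && over k x y) =
  (y \in Interval (BSide (x <= center k)
     (Num.sqrt (radius k ^+ 2 - (x - center k) ^+ 2))) +oo%O).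
Proof.
move=> xk; rewrite in_itv/= /over andbT.
set d := (x - center k) ^+ 2; set r := radius k ^+ 2.
have q0 : 0 < r - d.
  by rewrite subr_gt0 /d -real_normK ?num_real//; apply: ltr_sqr2.
have s0 : 0 < Num.sqrt (r - d) by rewrite sqrtr_gt0.
have ltE : 0 < y -> (r < d + y ^+ 2) = (Num.sqrt (r - d) < y).
  move=> y0; rewrite -ltrBlDl -{1}(sqr_sqrtr (ltW q0)).
  by rewrite ltr_pXn2r ?nnegrE ?(ltW y0) ?(ltW s0).
have eqE : 0 < y -> (r == d + y ^+ 2) = (Num.sqrt (r - d) == y).
  move=> y0; rewrite -(inj_eq (addrI (- d))) addKr addrC -{1}(sqr_sqrtr (ltW q0)).
  by rewrite eqrXn2 ?(ltW y0) ?(ltW s0).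
have [y0|y0] := ltrP 0 y; last first.
  rewrite andFb; apply/esym/negbTE; rewrite -lteifNE.
  by case: (x <= center k) => /=; rewrite -?ltNge -?leNgt; [exact: le_lt_trans s0|
    exact: le_trans (ltW s0)].
rewrite ltE// eqE// andTb; case: (x <= center k) => /=.
  by rewrite andbT le_eqVlt orbC.
by rewrite andbF orbF.
Qed.

Definition density : measurableTypeR R * measurableTypeR R -> \bar R :=
  (fun p => ((p.2 ^+ 2)^-1)%:E) \_ (cartesian domain).

Lemma measurable_density : measurable_fun setT density.
Proof.
apply/(measurable_restrictT _ measurable_domain).
apply: measurable_funTS; apply/measurable_EFinP.
apply: measurable_fun_inv_ge0 => [|p]; last exact: sqr_ge0.
by apply: measurable_funX; exact: measurable_snd.
Qed.

Lemma density_ge0 p : (0 <= density p)%E.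
Proof.
by rewrite /density patchE; case: ifP => // _; rewrite lee_fin invr_ge0 sqr_ge0.
Qed.

Lemma integral_density_over k x : k = 0 \/ k = 1 -> `|x - center k| < radius k ->
  (\int[mu]_y density (x, y) = (arc_density (center k) (radius k) x)%:E)%E.
Proof.
move=> k01 xk.
rewrite -(@integral_inv_sqr R (x <= center k)); last first.
  by rewrite sqrtr_gt0 subr_gt0 -real_normK ?num_real//; apply: ltr_sqr2.
rewrite [RHS]integral_mkcond; apply: eq_integral => y _.
rewrite /density !patchE; congr (if _ then _ else _).
apply/idP/idP; rewrite !inE.
  by move=> /(domain_over y k01 xk); rewrite over_itv.
by move=> h; apply/(domain_over y k01 xk); rewrite over_itv.
Qed.

Lemma hyp_area_domain : hyp_area domain = (ideal_triangle_area + ideal_triangle_area)%E.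
Proof.
rewrite /hyp_area integral_mkcond -/density.
rewrite fubini_tonelli1; [|exact: measurable_density|exact: density_ge0].
(* Above these tile ends the fibre goes down to height 0 and the inner integral is infinite; they
   are discarded as a null set. *)
pose N : set R := [set - u; u].
have mN : measurable N by apply: measurableU; exact: measurable_set1.
have N0 : mu N = 0%E.
  apply: countable_lebesgue_measure0; apply: finite_set_countable.
  by rewrite finite_setU; split; exact: finite_set1.
rewrite (@ge0_negligible_integral _ _ _ mu setT N)//; last 2 first.
- by apply: measurable_fun_fubini_tonelli_F;
    [exact: measurable_density|exact: density_ge0].
- by move=> x _; apply: integral_ge0 => y _; exact: density_ge0.
pose I k : set R := [set` `](center k - radius k), (center k + radius k)[].
pose f k x := (arc_density (center k) (radius k) x)%:E.
have f0 k x : (0 <= (f k \_ (I k)) x)%E.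
  by rewrite patchE; case: ifP => // _; rewrite lee_fin arc_ge0.
have mf k (D : set R) : measurable_fun D (f k).
  by apply: measurable_funTS; apply/measurable_EFinP; exact: measurable_arc.
have mI k : measurable (I k) by exact: measurable_itv.
have mD : measurable (setT `\` N) by exact: measurableD.
pose h0 := f 0 \_ (I 0); pose h1 := f 1 \_ (I 1).
have key (x : R) : ~ N x -> (\int[mu]_y density (x, y) = h0 x + h1 x)%E.
  move=> {N0} Nx.
  have inI k : I k x <-> `|x - center k| < radius k.
    rewrite /I /= in_itv /= ltr_norml; split=> /andP[? ?]; apply/andP; lra.
  have [x0|x0] := boolP (`|x - center 0| < radius 0).
    rewrite (integral_density_over (or_introl erefl) x0) /h0 /h1 !patchE.
    rewrite mem_set; last exact/inI.
    rewrite memNset ?adde0// => /inI.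
    by move: x0; rewrite !ltr_norml center0 center1 radius0 radius1 => /andP[? ?] /andP[? ?]; have := u1; lra.
  have [x1|x1] := boolP (`|x - center 1| < radius 1).
    rewrite (integral_density_over (or_intror erefl) x1) /h0 /h1 !patchE.
    rewrite memNset; last by move=> /inI; apply/negP.
    by rewrite mem_set ?add0e//; exact/inI.
  rewrite /h0 /h1 !patchE memNset; last by move=> /inI; apply/negP.
  rewrite memNset; last by move=> /inI; apply/negP.
  rewrite adde0; apply: integral0_eq => y _; rewrite /density patchE memNset//.
  move=> /domainE/and5P[/= _ xa xb _ _]; apply: Nx; rewrite /N /=.
  move: x0 x1; rewrite center0 center1 radius0 radius1 -!leNgt subr0.
  rewrite !ler_normr => /orP[x0|x0] /orP[x1|x1]; have := u1 => u1'.
  - by exfalso; lra.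
  - by right; lra.
  - by exfalso; lra.
  - by left; lra.
transitivity (\int[mu]_(x in setT `\` N) (h0 x + h1 x))%E.
  by apply: eq_integral => x; rewrite inE => -[_ Nx]; exact: key.
rewrite ge0_integralD//=; last 4 first.
- by move=> x _; exact: f0.
- by apply/measurable_funTS; apply/(measurable_restrictT _ (mI 0)); exact: mf.
- by move=> x _; exact: f0.
- by apply/measurable_funTS; apply/(measurable_restrictT _ (mI 1)); exact: mf.
rewrite /h0 /h1 -!integral_mkcondr.
have tile k : k = 0 \/ k = 1 -> (setT `\` N) `&` I k = I k.
  move=> k01; apply/setIidPr => x; rewrite /I /N /= in_itv /= => /andP[x1 x2]; split => //.
  move=> [] xu; move: k01 x1 x2 => [] ->;
  by rewrite ?center0 ?center1 ?radius0 ?radius1; have := u1; lra.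
rewrite !tile; [|by right|by left].
by congr (_ + _)%E; apply: integral_arc; exact: radius_gt0.
Qed.

Lemma hyp_area_finite (p q : R[i]) (D : set R[i]) :
  D `<=` [set p; q] -> hyp_area D = 0%E.
Proof.
move=> Dpq; rewrite /hyp_area.
have single (w : R[i]) : measurable (cartesian [set w]) /\
    (mu \x mu)%E (cartesian [set w]) = 0%E.
  have -> : cartesian [set w] = [set Re w] `*` [set Im w].
    apply/seteqP; split=> [[a b] /= <-|[a b] /= [-> ->]] //.
    by case: w.
  split; first by apply: measurableX; exact: measurable_set1.
  transitivity (mu [set Re w] * mu [set Im w])%E.
    by apply: product_measure1E; exact: measurable_set1.
  by rewrite lebesgue_measure_set1 mul0e.
have sub1 (w : R[i]) : measurable (cartesian (D `&` [set w])) /\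
    (mu \x mu)%E (cartesian (D `&` [set w])) = 0%E.
  have [Dw|Dw] := pselect (D w).
    by rewrite (_ : D `&` [set w] = [set w]) //; apply/setIidPr => _ ->.
  rewrite (_ : D `&` [set w] = set0); last by apply/seteqP; split=> // _ [/[swap] ->].
  by rewrite /cartesian /= -[X in measurable X]/set0 -[X in _ X = _]/set0 measure0.
have -> : cartesian D = cartesian (D `&` [set p]) `|` cartesian (D `&` [set q]).
  apply/seteqP; split=> [x Dx|x [][]//].
  by case: (Dpq _ Dx); [left|right].
apply: null_set_integral.
- by apply: measurableU; have [] := sub1 p; have [] := sub1 q.
- apply: measurable_funTS; apply/measurable_EFinP.
  apply: measurable_fun_inv_ge0 => [|x]; last exact: sqr_ge0.
  by apply: measurable_funX; exact: measurable_snd.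
- have [mp p0] := sub1 p; have [mq q0] := sub1 q.
  by transitivity ((mu \x mu)%E (cartesian (D `&` [set p]))) => //; exact: measureU0.
Qed.

Lemma tiling_group_fundamental_domain : fundamental_domain G domain.
Proof.
have [GS G1 GN GM GV] := tiling_group_psl2 u1.
split.
- by move=> z [].
- exact: measurable_domain.
- exact: domain_covers.
- move=> g Gg g1 gN1.
  apply: (@hyp_area_finite (center 0 +i* radius 0)%C (center 1 +i* radius 1)%C).
  move=> w [Dw [z Dz zw]]; rewrite -zw; rewrite -zw in Dw.
  exact: (domain_overlap u1 Gg g1 gN1 Dz Dw).
Qed.

Lemma tiling_group_coarea :
  has_coarea G (fine (@ideal_triangle_area R) + fine (@ideal_triangle_area R))%:E.
Proof.
exists domain; first exact: tiling_group_fundamental_domain.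
by rewrite hyp_area_domain EFinD fineK// ideal_triangle_area_fin.
Qed.

End DomainArea.

(** * Real quadratic units of norm 1 *)

Section QuadraticUnit.
Context {R : realType}.
Variables (m : nat) (u : R).

(* The norm being 1, the conjugate of u is 1/u; m is the trace of u. *)
Definition quadratic_unit : Prop :=
  [/\ 1 <= u, u ^+ 2 = m%:R * u - 1 &
      forall a b : rat, ratr a + ratr b * u = 0 -> b = 0].

Hypothesis qu : quadratic_unit.
Let u1 : 1 <= u := let: And3 h _ _ := qu in h.
Implicit Types (x y : R) (a b : rat).
Local Notation G := (tiling_group u).

Lemma unit_neq0 : u != 0.
Proof. by rewrite gt_eqF// (lt_le_trans _ u1). Qed.

Lemma unit_inv : u^-1 = m%:R - u.
Proof.
have [_ uu _] := qu; apply: (mulfI unit_neq0).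
by rewrite divff ?unit_neq0// mulrBr -expr2 uu; ring.
Qed.

Lemma unit_lt : 1 < u.
Proof.
rewrite lt_neqAle u1 andbT; apply/eqP => uE; have [_ _ irr] := qu.
have := irr (-1) 1; rewrite -uE rmorphN !rmorph1 mulr1 addNr => /(_ erefl) /eqP.
by rewrite oner_eq0.
Qed.

(** The graph of the Galois conjugation of Q(u), as a relation between reals; the irrationality of u
    makes it functional. *)
Definition conj_pair x y : Prop :=
  exists a b, x = ratr a + ratr b * u /\ y = ratr a + ratr b * u^-1.

Lemma conj_pair_inj a b a' b' :
  ratr a + ratr b * u = ratr a' + ratr b' * u -> a = a' /\ b = b'.
Proof.
move=> e; have [_ _ irr] := qu.
have bb : b = b'.
  apply/eqP; rewrite -subr_eq0; apply/eqP; apply: (irr (a - a')).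
  by rewrite !rmorphB /=; move: e; rewrite mulrBl => e; lra.
split=> //; move: e; rewrite bb => /addIr; exact: fmorph_inj.
Qed.

Lemma conj_pair_fun x y y' : conj_pair x y -> conj_pair x y' -> y = y'.
Proof.
by move=> [a [b [-> ->]]] [a' [b' [/conj_pair_inj[-> ->] ->]]].
Qed.

Lemma conj_pair_rat a : conj_pair (ratr a) (ratr a).
Proof. by exists a, 0; rewrite rmorph0 !mul0r !addr0. Qed.

Lemma conj_pair_unit : conj_pair u u^-1.
Proof. by exists 0, 1; rewrite rmorph0 rmorph1 !mul1r !add0r. Qed.

Lemma conj_pairB x y x' y' : conj_pair x x' -> conj_pair y y' ->
  conj_pair (x - y) (x' - y').
Proof.
move=> [a [b [-> ->]]] [c [d [-> ->]]]; exists (a - c), (b - d).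
by rewrite !rmorphB; split; ring.
Qed.

Lemma conj_pair_sym x y : conj_pair x y -> conj_pair y x.
Proof.
move=> [a [b [-> ->]]]; exists (a + b * m%:R), (- b).
by rewrite !rmorphD rmorphM rmorphN /= ratr_nat unit_inv; split; ring.
Qed.

Lemma conj_pairM x y x' y' : conj_pair x x' -> conj_pair y y' ->
  conj_pair (x * y) (x' * y').
Proof.
have [_ uu _] := qu.
have vv : u^-1 ^+ 2 = m%:R * u^-1 - 1 by rewrite unit_inv; move: uu => uu; nra.
move=> [a [b [-> ->]]] [c [d [-> ->]]].
exists (a * c - b * d), (a * d + b * c + b * d * m%:R).
rewrite !(rmorphD, rmorphB, rmorphM) /= ratr_nat; split.
  transitivity (ratr a * ratr c + (ratr a * ratr d + ratr b * ratr c) * u +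
    ratr b * ratr d * u ^+ 2); first by ring.
  by rewrite uu; ring.
transitivity (ratr a * ratr c + (ratr a * ratr d + ratr b * ratr c) * u^-1 +
  ratr b * ratr d * u^-1 ^+ 2); first by ring.
by rewrite vv; ring.
Qed.

Lemma conj_pair_neq0 x y : conj_pair x y -> x != 0 -> y != 0.
Proof.
move=> [a [b [-> ->]]] x0; apply/eqP => y0.
have h : conj_pair 0 (ratr a + ratr b * u) by apply: conj_pair_sym; exists a, b.
have h0 : conj_pair 0 0 by have := conj_pair_rat 0; rewrite rmorph0.
by rewrite (conj_pair_fun h h0) eqxx in x0.
Qed.

(** The norm x y is rational, so each inverse is a rational multiple of the other conjugate. *)
Lemma conj_pairV x y : conj_pair x y -> conj_pair x^-1 y^-1.
Proof.
have [->|x0] := eqVneq x 0 => xy.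
  have := conj_pair_rat 0; rewrite rmorph0 => h0.
  by rewrite (conj_pair_fun xy h0) invr0.
have y0 := conj_pair_neq0 xy x0.
have nxy : exists q : rat, x * y = ratr q.
  move: xy => [a [b [-> ->]]]; exists (a ^+ 2 + a * b * m%:R + b ^+ 2).
  rewrite !(rmorphD, rmorphM, rmorphXn) /= ratr_nat.
  transitivity (ratr a ^+ 2 + ratr a * ratr b * (u + u^-1) + ratr b ^+ 2 * (u * u^-1)).
    by ring.
  by rewrite divff ?unit_neq0// unit_inv; ring.
have [q xyq] := nxy.
have -> : x^-1 = y * ratr q^-1 by rewrite fmorphV /= -xyq invfM mulrA mulrAC divff// mul1r.
have -> : y^-1 = x * ratr q^-1 by rewrite fmorphV /= -xyq invfM mulrA divff// mul1r.
by apply: conj_pairM (conj_pair_rat _); exact: conj_pair_sym.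
Qed.

Definition quadratic_field : set R := [set x | exists y, conj_pair x y].

Lemma quadratic_fieldP x : quadratic_field x <-> exists a b, x = ratr a + ratr b * u.
Proof.
split=> [[y [a [b [-> _]]]]|[a [b ->]]]; first by exists a, b.
by exists (ratr a + ratr b * u^-1), a, b.
Qed.

Lemma quadratic_field_divring_closed : divring_closed (mem quadratic_field).
Proof.
split.
- by apply/mem_set; exists 1; have := conj_pair_rat 1; rewrite rmorph1.
- by move=> x y /set_mem[x' xx] /set_mem[y' yy]; apply/mem_set; exists (x' - y');
    exact: conj_pairB.
- by move=> x y /set_mem[x' xx] /set_mem[y' yy]; apply/mem_set; exists (x' / y');
    apply: conj_pairM => //; exact: conj_pairV.
Qed.

Definition unit_order : set R := [set x | exists c d : int, x = c%:~R + d%:~R * u].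

Lemma unit_order_int (c : int) : unit_order c%:~R.
Proof. by exists c, 0; rewrite mul0r addr0. Qed.

Lemma unit_order1 : unit_order 1. Proof. exact: (unit_order_int 1). Qed.
Lemma unit_order0 : unit_order 0. Proof. exact: (unit_order_int 0). Qed.

Lemma unit_order_unit : unit_order u.
Proof. by exists 0, 1; rewrite mul1r add0r. Qed.

Lemma unit_orderN x : unit_order x -> unit_order (- x).
Proof. by move=> [c [d ->]]; exists (- c), (- d); rewrite !rmorphN /=; ring. Qed.

Lemma unit_orderD x y : unit_order x -> unit_order y -> unit_order (x + y).
Proof.
by move=> [c [d ->]] [c' [d' ->]]; exists (c + c'), (d + d'); rewrite !rmorphD /=; ring.
Qed.

Lemma unit_orderM x y : unit_order x -> unit_order y -> unit_order (x * y).
Proof.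
have [_ uu _] := qu.
move=> [a [b ->]] [c [d ->]]; exists (a * c - b * d), (a * d + b * c + b * d * m%:Z).
rewrite !(rmorphD, rmorphB, rmorphM) /= -pmulrn.
transitivity (a%:~R * c%:~R + (a%:~R * d%:~R + b%:~R * c%:~R) * u +
    b%:~R * d%:~R * u ^+ 2); first by ring.
by rewrite uu; ring.
Qed.

Lemma unit_order_inv : unit_order u^-1.
Proof. by rewrite unit_inv; exists m%:Z, (-1); rewrite rmorphN1; ring. Qed.

Lemma unit_order_field x : unit_order x -> quadratic_field x.
Proof.
by move=> [c [d ->]]; apply/quadratic_fieldP; exists c%:~R, d%:~R; rewrite !ratr_int.
Qed.

Lemma unit_order_integral x : unit_order x -> integralOver (intr : int -> R) x.
Proof.
have [_ uu _] := qu.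
move=> [c [d ->]].
(* The characteristic polynomial of c + d u, of trace 2c + d m and norm c^2 + c d m + d^2. *)
pose p : {poly int} := 'X^2 - (2 * c + d * m%:Z)%:P * 'X + (c ^+ 2 + c * d * m%:Z + d ^+ 2)%:P.
exists p.
  have s1 e : (size (- (e%:P * 'X) : {poly int}) < size ('X^2 : {poly int}))%N.
    by rewrite size_polyN mul_polyC size_polyXn ltnS (leq_trans (size_scale_leq _ _))// size_polyX.
  rewrite monicE /p lead_coefDl ?lead_coefDl ?lead_coefXn//.
  by rewrite size_polyDl// (leq_ltn_trans (size_polyC_leq1 _))// size_polyXn.
rewrite /root /p rmorphD rmorphB /= map_polyXn rmorphM /= map_polyX !map_polyC /=.
rewrite !hornerE !(rmorphD, rmorphM) /= -pmulrn.
apply/eqP; transitivity (d%:~R ^+ 2 * (u ^+ 2 - m%:R * u + 1) : R); last by rewrite uu; ring.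
by ring.
Qed.

(** Half-turns divide by the radii 1 and u, which are units of Z[u]; determinant 1 keeps inverses
    integral. *)
Lemma tiling_group_order g : G g -> forall i j, unit_order (g i j).
Proof.
pose S : set 'M[R]_2 := [set g | \det g = 1 /\ forall i j, unit_order (g i j)].
have ent (a b c d : R) : unit_order a -> unit_order b -> unit_order c -> unit_order d ->
    forall i j, unit_order (mx2 a b c d i j).
  by move=> ? ? ? ? i j; rewrite mxE; case: ifP => _; case: ifP.
have PS : psl2_subgroup S.
  split.
  - by move=> h [].
  - split; first by rewrite det1.
    by rewrite one_mx2; apply: ent; rewrite ?unit_order0 ?unit_order1//;
      [exact: unit_order1|exact: unit_order0|exact: unit_order0|exact: unit_order1].
  - split; first by rewrite detN_mx2 det1.
    rewrite one_mx2 oppmx2; apply: ent; apply: unit_orderN;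
      [exact: unit_order1|exact: unit_order0|exact: unit_order0|exact: unit_order1].
  - move=> g' h [g1 gS] [h1 hS]; split; first by rewrite det_mx2M g1 h1 mulr1.
    by rewrite mulmx2; apply: ent; apply: unit_orderD; apply: unit_orderM.
  - move=> h [h1 hS]; rewrite inv_mx2//; split.
      by rewrite det_mx2E !mx2E -h1 det_mx2E; ring.
    by apply: ent => //; exact: unit_orderN.
move=> Gg; suff [] : S g by [].
have u2 : unit_order (u + 1) by apply: unit_orderD; [exact: unit_order_unit|exact: unit_order1].
apply: Gg; split=> // _ [[]|] ->; split;
  rewrite ?det_shift ?det_half_turn//; apply: ent;
  rewrite ?center0 ?center1 ?radius0 ?radius1 ?invr1 ?mul1r ?mul0r ?oppr0 ?mulr1 //;
  try exact: unit_order1; try exact: unit_order0; try exact: unit_order_inv => //.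
- apply: unit_orderM; [exact: (unit_order_int 2)|exact: u2].
- rewrite expr0n add0r expr2 mulNr mulfK ?unit_neq0//; apply: unit_orderN.
  exact: unit_order_unit.
- by rewrite mul0r; exact: unit_order0.
- apply: unit_orderN; rewrite expr1n; apply: unit_orderD; last exact: unit_order1.
  by apply: unit_orderM.
- exact: unit_orderN.
Qed.

End QuadraticUnit.

(** * Invariant trace field and quaternion algebra *)

Section TraceField.
Context {R : realType}.
Variables (m : nat) (u : R).
Hypothesis qu : quadratic_unit m u.
Let u1 : 1 <= u := let: And3 h _ _ := qu in h.
Let u0 : u != 0 := unit_neq0 qu.
Local Notation G := (tiling_group u).
Local Notation K := (inv_trace_field G).
Local Notation A := (inv_quat_algebra G).
Implicit Types (x y : R) (a b : rat) (n : int).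

Lemma squares_subgroup_psl2 : psl2_subgroup (squares_subgroup G).
Proof.
have [GS _ _ _ _] := tiling_group_psl2 u1.
apply: smallest_psl2_subgroup => _ [g Gg <-] /=.
by rewrite expr2 det_mx2M (GS _ Gg) mulr1.
Qed.

Lemma squares_subgroup_sub : squares_subgroup G `<=` G.
Proof.
have GP := tiling_group_psl2 u1; have [_ _ _ GM _] := GP.
by move=> g; apply; split=> // _ [h Gh <-]; rewrite expr2; exact: GM.
Qed.

Lemma squares_subgroup_sqr g : G g -> squares_subgroup G (g ^+ 2).
Proof. by move=> Gg S [_]; apply; exists g. Qed.

Lemma squares_subgroup_shift n : squares_subgroup G (shift u (2 * n)).
Proof.
have -> : shift u (2 * n) = shift u n ^+ 2.
  by rewrite expr2 shiftM; congr (shift _ _); ring.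
by apply: squares_subgroup_sqr; exact: tiling_group_shift.
Qed.

(** The half-turn about tile 0 swaps 0 and infinity; conjugating the squared translation by it gives
    this parabolic fixing 0. *)
Definition lower_parabolic : 'M[R]_2 := mx2 1 0 (- (4 * (u + 1) / u ^+ 2)) 1.

Lemma squares_subgroup_lower : squares_subgroup G lower_parabolic.
Proof.
have [_ _ _ GM GV] := tiling_group_psl2 u1.
have -> : lower_parabolic = (half_turn u 0 * shift u 1 * (half_turn u 0)^-1) ^+ 2.
  rewrite inv_half_turn// expr2 /half_turn /rotation /shift /translation center0 radius0 oppmx2.
  rewrite !mulmx2; apply: mx2P; rewrite !mx2E; field => //.
apply: squares_subgroup_sqr; apply: (GM); last first.
  by apply: GV; exact: tiling_group_half_turn.
by apply: GM; [exact: tiling_group_half_turn|exact: tiling_group_shift].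
Qed.

(** Two parabolics with distinct fixed points have a product whose trace is affine in n, and (u +
    1)^2 = (m + 2) u simplifies it. The value at n = 1 generates Q(u); letting n grow makes the
    traces unbounded. *)
Lemma trace_set_witness n : trace_set G (2 - 16 * n%:~R * (m%:R + 2) / u).
Proof.
have [_ uu _] := qu; have [_ _ _ SM _] := squares_subgroup_psl2.
exists (shift u (2 * n) * lower_parabolic).
  by apply: SM; [exact: squares_subgroup_shift|exact: squares_subgroup_lower].
rewrite tr_mx2E mulmx2 !mx2E intrM.
transitivity (2 - 16 * n%:~R * (u ^+ 2 + 2 * u + 1) / u ^+ 2 : R); first by field.
have -> : u ^+ 2 + 2 * u + 1 = (m%:R + 2) * u by rewrite uu; ring.
by field.
Qed.

Lemma trace_set_order x : trace_set G x -> unit_order u x.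
Proof.
move=> [g /squares_subgroup_sub Gg <-]; rewrite tr_mx2E.
by apply: unit_orderD; exact: (tiling_group_order qu Gg).
Qed.

Lemma ratr_trace_field a : ratr a \in trace_field G.
Proof. by rewrite /ratr rpred_div// rpred_int. Qed.

Lemma trace_fieldP x : (x \in trace_field G) <-> quadratic_field u x.
Proof.
split=> [/set_mem|].
  apply; split; first exact: (quadratic_field_divring_closed qu).
  by move=> y /trace_set_order; exact: unit_order_field.
move=> /quadratic_fieldP[a [b ->]].
suff uK : u \in trace_field G by apply: rpredD; [|apply: rpredM => //]; exact: ratr_trace_field.
have t1 : 2 - 16 * 1%:~R * (m%:R + 2) / u \in trace_field G.
  by apply/mem_set => S [_]; apply; exact: trace_set_witness.
have m2 : (m%:R + 2 : R) != 0 by rewrite -natrD pnatr_eq0 addn2.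
have uE : u = (16 * (m%:R + 2)) / (2 - (2 - 16 * 1%:~R * (m%:R + 2) / u)).
  have -> : 2 - (2 - 16 * 1%:~R * (m%:R + 2) / u) = 16 * (m%:R + 2) / u by ring.
  by rewrite invf_div mulrC divfK// mulf_neq0.
rewrite [X in X \in _]uE.
apply: rpred_div; last by apply: rpredB => //; exact: rpred_nat.
by apply: rpredM; [exact: rpred_nat|apply: rpredD; exact: rpred_nat].
Qed.

Lemma unit_trace_field : u \in trace_field G.
Proof. by apply/trace_fieldP/unit_order_field/unit_order_unit. Qed.

Definition field_unit : K := Sub u unit_trace_field.

Definition incl : {rmorphism K -> R} := val.

Lemma incl_unit : incl field_unit = u. Proof. exact: SubK. Qed.

Lemma incl_inj : injective incl. Proof. exact: val_inj. Qed.

Lemma embedding_rat (S : unitRingType) (f : {rmorphism K -> S}) a : f (ratr a) = ratr a.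
Proof. exact: fmorph_rat. Qed.

Lemma trace_field_basis (x : K) : exists a b, x = ratr a + ratr b * field_unit.
Proof.
have /trace_fieldP/quadratic_fieldP[a [b xE]] := valP x.
exists a, b; apply: incl_inj; rewrite rmorphD embedding_rat rmorphM embedding_rat incl_unit.
exact: xE.
Qed.

Lemma inv_trace_field_number_field : number_field K.
Proof.
split.
  move=> p; rewrite -(fmorph_pchar incl).
  by rewrite pchar_num.
exists 2%N, (fun i : 'I_2 => if i == 0 then 1 else field_unit) => x.
have [a [b ->]] := trace_field_basis x.
exists (fun i : 'I_2 => if i == 0 then a else b).
by rewrite !big_ord_recl big_ord0 /= mulr1 addr0.
Qed.

Lemma embedding_unit (S : fieldType) (f : {rmorphism K -> S}) :
  f field_unit ^+ 2 = m%:R * f field_unit - 1.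
Proof.
have [_ uu _] := qu.
have e : field_unit ^+ 2 = m%:R * field_unit - 1.
  apply: incl_inj.
  by rewrite rmorphXn rmorphB rmorph1 rmorphM incl_unit rmorph_nat.
by rewrite -rmorphXn e rmorphB rmorph1 rmorphM rmorph_nat.
Qed.

Lemma inv_trace_field_totally_real : @totally_real R K.
Proof.
have [_ uu _] := qu.
move=> f x; have [a [b ->]] := trace_field_basis x.
rewrite rmorphD embedding_rat rmorphM embedding_rat.
have rat_real c : ratr c = ((ratr c : R)%:C)%C :> R[i] by rewrite fmorph_rat.
have : (f field_unit - u%:C%C) * (f field_unit - (u^-1)%:C%C) = 0.
  transitivity (f field_unit ^+ 2 - (u + u^-1)%:C%C * f field_unit + (u * u^-1)%:C%C).
    by rewrite rmorphD rmorphM /=; ring.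
  have -> : u + u^-1 = m%:R by rewrite (unit_inv qu) addrC subrK.
  by rewrite embedding_unit divff// rmorph_nat rmorph1; ring.
move=> /eqP; rewrite mulf_eq0 !subr_eq0 => /orP[] /eqP ->.
  by rewrite !rat_real -rmorphM -rmorphD.
by rewrite !rat_real -rmorphM -rmorphD.
Qed.

(** The traces 2 - n q, with q nonzero in the field, go to 2 - n f(q), and f(q) is nonzero since f
    is injective. *)
Lemma embedding_bounded (f : {rmorphism K -> R}) : unbounded_embedding f.
Proof.
move=> [M [_ HM]]; have m2 : (m%:R + 2 : R) != 0 by rewrite -natrD pnatr_eq0 addn2.
pose q : K := (16 * (m + 2))%:R / field_unit.
have iq : incl q = 16 * (m%:R + 2) / u.
  by rewrite fmorph_div rmorph_nat incl_unit natrM natrD.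
have q0 : f q != 0.
  by rewrite fmorph_eq0 -(fmorph_eq0 incl) iq mulf_neq0 ?invr_neq0// mulf_neq0.
have two (S : fieldType) (g : {rmorphism K -> S}) (n : nat) :
  g (2 - n%:R * q) = 2 - n%:R * g q.
  by rewrite rmorphB rmorph_nat rmorphM rmorph_nat.
have tq (n : nat) : `|2 - n%:R * f q| <= `|M| + 1.
  apply: (HM (`|M| + 1)); first by rewrite (le_lt_trans (ler_norm _))// ltrDl.
  exists (2 - n%:R * q); last by rewrite two.
  have -> : [set t | trace_set G (\val t)] (2 - n%:R * q) =
      trace_set G (2 - n%:R * (16 * (m%:R + 2) / u)) by rewrite -iq -two.
  have := trace_set_witness n; rewrite -pmulrn.
  by congr (trace_set _ _); field.
have fq : 0 < `|f q| by rewrite normr_gt0.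
pose n := (Num.truncn ((`|M| + 3) / `|f q|)).+1.
have : (`|M| + 3) < n%:R * `|f q| by rewrite -ltr_pdivrMr// truncnS_gt.
have := tq n; have := ler_distD 2 (n%:R * f q) 0.
rewrite !subr0 normrM normr_nat distrC (@ger0_norm _ 2)//; lra.
Qed.

End TraceField.

(** * Matrix units as a basis of 2 by 2 matrices *)

Section Delta4.
Context {S : nzRingType}.
Let o1 : 'I_4 := lift ord0 ord0.
Let o2 : 'I_4 := lift ord0 (lift ord0 ord0).
Let o3 : 'I_4 := lift ord0 (lift ord0 (lift ord0 ord0)).

Definition index4 (k : 'I_4) : 'I_2 * 'I_2 := nth (0, 0) [:: (0, 0); (0, 1); (1, 0); (1, 1)] k.

Lemma ord4P (P : 'I_4 -> Prop) : P ord0 -> P o1 -> P o2 -> P o3 -> forall k, P k.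
Proof.
move=> p0 p1 p2 p3 [[|[|[|[|//]]]] kp].
- by rewrite (_ : Ordinal kp = ord0)//; exact/val_inj.
- by rewrite (_ : Ordinal kp = o1)//; exact/val_inj.
- by rewrite (_ : Ordinal kp = o2)//; exact/val_inj.
- by rewrite (_ : Ordinal kp = o3)//; exact/val_inj.
Qed.

Lemma sum_delta4 (c : 'I_4 -> S) :
  \sum_k c k *: delta_mx (index4 k).1 (index4 k).2 =
  \matrix_(i, j) if i == 0 :> 'I_2 then if j == 0 :> 'I_2 then c ord0 else c o1
                 else if j == 0 then c o2 else c o3.
Proof.
rewrite !big_ord_recl big_ord0 addr0 -/o1 -/o2 -/o3.
apply/matrixP => -[[|[|//]] ip] -[[|[|//]] jp]; rewrite !mxE /=;
  by rewrite !(mulr0, mulr1, addr0, add0r).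
Qed.

Lemma matrix_sum_delta4 (x : 'M[S]_2) :
  x = \sum_k x (index4 k).1 (index4 k).2 *: delta_mx (index4 k).1 (index4 k).2.
Proof.
rewrite (sum_delta4 (fun k => x _ _)); apply/matrixP => i j; rewrite mxE.
by case: i j => [[|[|//]] ip] [[|[|//]] jp] /=; congr (x _ _); exact/val_inj.
Qed.

Lemma delta4_basis (x : 'M[S]_2) : exists! c : {ffun 'I_4 -> S},
  x = \sum_k c k *: delta_mx (index4 k).1 (index4 k).2.
Proof.
exists [ffun k => x (index4 k).1 (index4 k).2]; split.
  by rewrite {1}[x]matrix_sum_delta4; apply: eq_bigr => k _; rewrite ffunE.
move=> c; rewrite sum_delta4 => xE; apply/ffunP; apply: ord4P;
  by rewrite ffunE xE mxE.
Qed.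
End Delta4.

(** Counting embeddings requires equality of bundled morphisms, whose proof components are
    irrelevant. *)
Lemma rmorphism_eq (A B : nzRingType) (f g : {rmorphism A -> B}) : f =1 g -> f = g.
Proof.
case: f g => [f [[a] [b]]] [g [[c] [d]]] /= /funext fg.
by case: _ / fg in c d *; rewrite (Prop_irrelevance a c) (Prop_irrelevance b d).
Qed.

(** * Real embeddings and splitting of the quaternion algebra *)

Section Embeddings.
Context {R : realType}.
Variables (m : nat) (u : R).
Hypothesis qu : quadratic_unit m u.
Let u1 : 1 <= u := let: And3 h _ _ := qu in h.
Let u0 : u != 0 := unit_neq0 qu.
Local Notation G := (tiling_group u).
Local Notation K := (inv_trace_field G).
Local Notation A := (inv_quat_algebra G).
Local Notation U := (field_unit qu).
Implicit Types (x y : R) (a b : rat) (n : int).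

Lemma val_conj_pair (x : K) : exists y, conj_pair u (val x) y.
Proof. by have /(trace_fieldP qu) := valP x. Qed.

(** A choice in the conjugation relation; the morphism laws follow from uniqueness of the
    conjugate. *)
Definition conj_fun (x : K) : R := sval (cid (val_conj_pair x)).

Lemma conj_funP (x : K) : conj_pair u (val x) (conj_fun x).
Proof. exact: svalP. Qed.

Lemma conj_fun_is_zmod_morphism : zmod_morphism conj_fun.
Proof.
move=> x y; apply: (conj_pair_fun qu (conj_funP _)).
exact: (conj_pairB (conj_funP x) (conj_funP y)).
Qed.

Lemma conj_fun_is_monoid_morphism : monoid_morphism conj_fun.
Proof.
split.
  apply: (conj_pair_fun qu (conj_funP _)).
  by have := conj_pair_rat u 1; rewrite rmorph1.
move=> x y; apply: (conj_pair_fun qu (conj_funP _)).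
exact: (conj_pairM qu (conj_funP x) (conj_funP y)).
Qed.

HB.instance Definition _ := GRing.isZmodMorphism.Build K R conj_fun conj_fun_is_zmod_morphism.
HB.instance Definition _ := GRing.isMonoidMorphism.Build K R conj_fun conj_fun_is_monoid_morphism.

Definition conj_embedding : {rmorphism K -> R} := conj_fun.

Lemma conj_embedding_unit : conj_embedding U = u^-1.
Proof.
apply: (conj_pair_fun qu (conj_funP _)).
have -> : val U = u by exact: (incl_unit qu).
exact: conj_pair_unit.
Qed.

Lemma conj_embeddingP x y (k : K) : val k = x -> conj_pair u x y -> conj_embedding k = y.
Proof. by move=> <- /(conj_pair_fun qu (conj_funP k)). Qed.

(** An embedding is determined by the image of u, a root of x^2 - m x + 1 = (x - u)(x - 1/u). *)
Lemma embedding_dichotomy (f : {rmorphism K -> R}) : f = incl u \/ f = conj_embedding.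
Proof.
have [_ uu _] := qu.
have eqU (g h : {rmorphism K -> R}) : g U = h U -> g = h.
  move=> gh; apply: rmorphism_eq => x; have [a [b ->]] := trace_field_basis qu x.
  have lin (k : {rmorphism K -> R}) : k (ratr a + ratr b * U) = ratr a + ratr b * k U.
    by rewrite rmorphD embedding_rat rmorphM embedding_rat.
  by rewrite !lin gh.
have : (f U - u) * (f U - u^-1) = 0.
  transitivity (f U ^+ 2 - (u + u^-1) * f U + (u * u^-1)); first by ring.
  have -> : u + u^-1 = m%:R by rewrite (unit_inv qu) addrC subrK.
  by rewrite embedding_unit divff//; ring.
move=> /eqP; rewrite mulf_eq0 !subr_eq0 => /orP[] /eqP fU; [left|right]; apply: eqU.
  by rewrite fU incl_unit.
by rewrite fU conj_embedding_unit.
Qed.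

Lemma arith_dim_two : has_arith_dim G 2.
Proof.
pose e (n : nat) : {rmorphism K -> R} := if n == 0%N then incl u else conj_embedding.
rewrite /has_arith_dim; have -> : [set f | @unbounded_embedding R G f] = e @` `I_2.
  apply/seteqP; split=> [f _|f _]; last exact: (embedding_bounded qu).
  by case: (embedding_dichotomy f) => ->; [exists 0%N|exists 1%N].
apply: inj_card_eq => i j /set_mem /= i2 /set_mem /= j2 eij.
have neq : incl u <> conj_embedding.
  move=> ic; have : u = u^-1.
    by rewrite -conj_embedding_unit -ic incl_unit.
  have lu := unit_lt qu; move=> /eqP; rewrite -(inj_eq (mulfI u0)) divff// -expr2.
  rewrite gt_eqF// -[ltLHS](expr1n R 2); exact: ltr_sqr2.
move: eij; rewrite /e; case: i i2 => [|[|//]] _; case: j j2 => [|[|//]] _ //=.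
by move=> /esym /neq.
Qed.

(** The upper and lower parabolics minus 1 are multiples of the two off-diagonal matrix units, whose
    products are the diagonal ones. *)
Lemma quat_algebraP (x : 'M[R]_2) :
  (x \in quat_algebra G) <-> forall i j, x i j \in trace_field G.
Proof.
split=> [/set_mem[s sS ->] i j|xK].
  rewrite summxE big_seq; apply: rpred_sum => p ps; rewrite mxE; apply: rpredM.
    exact: valP.
  apply/(trace_fieldP qu)/unit_order_field; apply: (tiling_group_order qu).
  by apply: (squares_subgroup_sub qu); exact: sS.
have scaleA (a : R) (y : 'M[R]_2) : a \in trace_field G -> y \in quat_algebra G -> a *: y \in quat_algebra G.
  move=> aK /set_mem[s sS ->]; apply/mem_set.
  exists [seq ((Sub a aK : K) * p.1, p.2) | p <- s].
    by move=> _ /mapP[p /sS pS ->].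
  rewrite big_map scaler_sumr; apply: eq_bigr => p _.
  by rewrite scalerA; congr (_ *: _); rewrite -[RHS]/(incl u _) rmorphM.
have sqA g : squares_subgroup G g -> g \in quat_algebra G.
  move=> gS; apply/mem_set; exists [:: (1, g)].
    by move=> p; rewrite inE => /eqP ->.
  by rewrite big_seq1 scale1r.
have uK := unit_trace_field qu.
have q1 : 1 \in quat_algebra G.
  by apply: (sqA); have [_ S1 _ _ _] := squares_subgroup_psl2 qu.
have u10 : u + 1 != 0 by rewrite lt0r_neq0// ltr_wpDl// (le_trans _ u1).
have e01 : mx2 0 1 0 0 \in quat_algebra G.
  have -> : mx2 0 1 0 0 = (4 * (u + 1))^-1 *: (shift u (2 * 1) - 1).
    by rewrite one_mx2; apply: mx2P; rewrite !mxE /=; field => //.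
  apply: (scaleA).
    by rewrite rpredV; apply: rpredM; [exact: rpred_nat|apply: rpredD => //; exact: rpred1].
  by apply: rpredB; [exact: (sqA _ (squares_subgroup_shift qu 1))|].
have e10 : mx2 0 0 1 0 \in quat_algebra G.
  have -> : mx2 0 0 1 0 = (- u ^+ 2 / (4 * (u + 1))) *: (lower_parabolic u - 1).
    by rewrite one_mx2; apply: mx2P; rewrite !mxE /=; field; rewrite ?u0 ?u10.
  apply: (scaleA).
    apply: rpred_div; first by rewrite rpredN rpredX.
    by apply: rpredM; [exact: rpred_nat|apply: rpredD => //; exact: rpred1].
  by apply: rpredB; [exact: (sqA _ (squares_subgroup_lower qu))|].
have -> : x = x 0 0 *: (mx2 0 1 0 0 * mx2 0 0 1 0) + x 0 1 *: mx2 0 1 0 0 +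
    (x 1 0 *: mx2 0 0 1 0 + x 1 1 *: (mx2 0 0 1 0 * mx2 0 1 0 0)).
  by rewrite !mulmx2; apply: mx2P; rewrite !mxE /=; ring.
by apply: rpredD; apply: rpredD; apply: (scaleA) => //; exact: rpredM.
Qed.

Section Split.
Variable f : {rmorphism K -> R}.

(** Zero outside the field, which makes it total on R so that [map_mx] applies; the entries that
    occur lie in the field. *)
Definition extend_entry (x : R) : R := f (insubd (0 : K) x).

Lemma extend_entryE (k : K) : extend_entry (val k) = f k.
Proof. by rewrite /extend_entry valKd. Qed.

Lemma extend_entryB x y : x \in trace_field G -> y \in trace_field G ->
  extend_entry (x - y) = extend_entry x - extend_entry y.
Proof.
move=> xK yK; pose k : K := Sub x xK; pose l : K := Sub y yK.
have <- : val (k - l) = x - y by exact: (rmorphB (incl u) k l).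
by rewrite extend_entryE rmorphB -(extend_entryE k) -(extend_entryE l).
Qed.

Lemma extend_entryM x y : x \in trace_field G -> y \in trace_field G ->
  extend_entry (x * y) = extend_entry x * extend_entry y.
Proof.
move=> xK yK; pose k : K := Sub x xK; pose l : K := Sub y yK.
have <- : val (k * l) = x * y by exact: (rmorphM (incl u) k l).
by rewrite extend_entryE rmorphM -(extend_entryE k) -(extend_entryE l).
Qed.

Lemma extend_entry1 : extend_entry 1 = 1.
Proof.
have <- : val (1 : K) = 1 by exact: (rmorph1 (incl u)).
by rewrite extend_entryE rmorph1.
Qed.

Lemma extend_entry0 : extend_entry 0 = 0.
Proof.
have <- : val (0 : K) = 0 by exact: (rmorph0 (incl u)).
by rewrite extend_entryE rmorph0.
Qed.

Definition extension (x : A) : 'M[R]_2 := map_mx extend_entry (val x).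

Lemma entry_in (x : A) i j : val x i j \in trace_field G.
Proof. by have /quat_algebraP := valP x. Qed.

Lemma extension_is_zmod_morphism : zmod_morphism extension.
Proof.
by move=> x y; apply/matrixP => i j; rewrite !mxE -extend_entryB ?entry_in.
Qed.

Lemma extend_entryD x y : x \in trace_field G -> y \in trace_field G ->
  extend_entry (x + y) = extend_entry x + extend_entry y.
Proof.
move=> xK yK; pose k : K := Sub x xK; pose l : K := Sub y yK.
have <- : val (k + l) = x + y by exact: (rmorphD (incl u) k l).
by rewrite extend_entryE rmorphD -(extend_entryE k) -(extend_entryE l).
Qed.

Lemma extension_is_monoid_morphism : monoid_morphism extension.
Proof.
split.
  apply/matrixP => i j; rewrite !mxE.
  by case: (i == j); rewrite ?extend_entry1 ?extend_entry0.
move=> x y; rewrite [RHS]mulmx2 /extension (_ : val (x * y) = val x * val y)//.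
have xK := entry_in x; have yK := entry_in y.
rewrite mulmx2; apply: mx2P; rewrite !mxE /=;
  by rewrite extend_entryD ?rpredM ?xK ?yK// !extend_entryM.
Qed.

HB.instance Definition _ :=
  GRing.isZmodMorphism.Build A 'M[R]_2 extension extension_is_zmod_morphism.
HB.instance Definition _ :=
  GRing.isMonoidMorphism.Build A 'M[R]_2 extension extension_is_monoid_morphism.

Lemma extension_extends : @extends R G f extension.
Proof.
move=> a x xE; apply/matrixP => i j; rewrite !mxE xE mxE.
by case: (i == j); rewrite ?mulr1n ?mulr0n ?extend_entryE ?extend_entry0.
Qed.

(** Applied entrywise, f fixes the matrix units, a basis on both sides. *)
Lemma all_split : @splits_over R G f.
Proof.
exists extension; split; first exact: extension_extends.
have unitA (i j : 'I_2) : delta_mx i j \in quat_algebra G.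
  by apply/quat_algebraP => k l; rewrite mxE rpred_nat.
pose d i j : A := Sub (delta_mx i j) (unitA i j).
have dE i j : val (d i j) = delta_mx i j by exact: SubK.
have rE i j : extension (d i j) = delta_mx i j.
  apply/matrixP => k l; rewrite mxE dE !mxE.
  by case: (_ && _); rewrite ?extend_entry1 ?extend_entry0.
exists 4%N, (fun k => d (index4 k).1 (index4 k).2); split; last first.
  move=> x; have [c [xE cu]] := delta4_basis x; exists c; split.
    by rewrite xE; apply: eq_bigr => k _; congr (_ *: _); exact/esym/rE.
  by move=> c' xE'; apply: cu; rewrite xE'; apply: eq_bigr => k _; congr (_ *: _); exact: rE.
move=> x; have [c [xE cu]] := delta4_basis (val x).
have cK k : c k \in trace_field G.
  suff -> : c = [ffun k => val x (index4 k).1 (index4 k).2] by rewrite ffunE entry_in.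
  apply: cu; rewrite {1}[val x]matrix_sum_delta4.
  by apply: eq_bigr => l _; rewrite ffunE.
exists [ffun k => Sub (c k) (cK k) : K]; split.
  by rewrite xE; apply: eq_bigr => k _; rewrite ffunE dE SubK.
move=> c' xE'; apply/ffunP => k; apply: val_inj; rewrite ffunE SubK.
have -> : c = [ffun k => val (c' k)]; last by rewrite ffunE.
by apply: cu; rewrite xE'; apply: eq_bigr => l _; rewrite ffunE dE.
Qed.
End Split.

End Embeddings.

(** * Commensurability *)

(** The trace of the k-th power of a matrix of determinant 1 and trace t: twice the Chebyshev
    polynomial at t/2. Being an integer polynomial in t, it commutes with conjugation. *)
Fixpoint power_trace {S : pzRingType} (t : S) (k : nat) : S :=
  match k with
  | 0 => 2
  | 1 => t
  | (k'.+1 as k1).+1 => t * power_trace t k1 - power_trace t k'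
  end.

Lemma power_traceSS {S : pzRingType} (t : S) k :
  power_trace t k.+2 = t * power_trace t k.+1 - power_trace t k.
Proof. by []. Qed.

Lemma mxtrace_exp (F : fieldType) (g : 'M[F]_2) k : \det g = 1 ->
  \tr (g ^+ k) = power_trace (\tr g) k.
Proof.
move=> g1; suff : \tr (g ^+ k) = power_trace (\tr g) k /\
  \tr (g ^+ k.+1) = power_trace (\tr g) k.+1 by case.
elim: k => [|k [IH0 IH1]]; first by rewrite expr0 expr1 mxtrace1.
split=> //; rewrite power_traceSS -IH0 -IH1.
have -> : g ^+ k.+2 = g ^+ 2 * g ^+ k by rewrite -exprD.
rewrite sqr_mx2 g1 mulrBl mul1r -scalerAl -exprS.
by rewrite !raddfB /= mxtraceZ.
Qed.

Lemma power_trace_lt (F : realDomainType) (s t : F) k : 2 <= t -> t < s ->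
  power_trace t k.+1 < power_trace s k.+1.
Proof.
move=> t2 ts.
(* Comparing the increments of both sequences is what lets the induction pass through the
   subtraction in the recurrence. *)
suff [] : [/\ power_trace t k.+1 < power_trace s k.+1, 2 <= power_trace t k.+1,
  0 <= power_trace t k.+1 - power_trace t k &
  power_trace t k.+1 - power_trace t k <= power_trace s k.+1 - power_trace s k] by [].
elim: k => [|k [h1 h2 h3 h4]]; first by split=> //=; lra.
rewrite !power_traceSS; set a := power_trace t k.+1 in h1 h2 h3 h4 *.
set b := power_trace s k.+1 in h1 h2 h3 h4 *.
by split; nra.
Qed.

Section Commensurability.
Context {R : realType}.
Variables (m m' : nat) (u u' : R).
Hypothesis qu : quadratic_unit m u.
Hypothesis qu' : quadratic_unit m' u'.
Hypothesis indep : forall a b a' b' : rat,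
  ratr a + ratr b * u = ratr a' + ratr b' * u' -> b = 0.
Let u1 : 1 <= u := let: And3 h _ _ := qu in h.
Let u1' : 1 <= u' := let: And3 h _ _ := qu' in h.

Definition hyperbolic : 'M[R]_2 := shift u 1 * half_turn u 0.

Lemma hyperbolicE : hyperbolic = mx2 (2 * (u + 1) / u) (- u) u^-1 0.
Proof.
have u0 := unit_neq0 qu.
rewrite /hyperbolic /half_turn /rotation center0 radius0 mulmx2.
by apply: mx2P; rewrite !mx2E; field.
Qed.

Lemma tr_hyperbolic : \tr hyperbolic = 2 * (1 + u^-1).
Proof.
have u0 := unit_neq0 qu.
by rewrite hyperbolicE tr_mx2E !mx2E; field.
Qed.

Lemma det_hyperbolic : \det hyperbolic = 1.
Proof. by rewrite det_mx2M det_shift det_half_turn// mulr1. Qed.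

Lemma hyperbolic_in : tiling_group u hyperbolic.
Proof.
have [_ _ _ GM _] := tiling_group_psl2 u1; have [? ? _] := tiling_group_gen u.
exact: GM.
Qed.

Lemma conj_pair_power_trace k :
  conj_pair u (power_trace (2 * (1 + u^-1)) k) (power_trace (2 * (1 + u)) k).
Proof.
have c2 : conj_pair u 2 2 by have := conj_pair_rat u 2; rewrite ratr_nat.
have c : conj_pair u (2 * (1 + u^-1)) (2 * (1 + u)).
  apply: (conj_pairM qu) => //.
  rewrite -[u^-1]opprK -[X in conj_pair _ _ (1 + X)]opprK.
  apply: conj_pairB; first by have := conj_pair_rat u 1; rewrite rmorph1.
  rewrite -[- u^-1]sub0r -[- u]sub0r; apply: conj_pairB.
    by have := conj_pair_rat u 0; rewrite rmorph0.
  by apply: (conj_pair_sym qu); exact: conj_pair_unit.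
suff [] : conj_pair u (power_trace (2 * (1 + u^-1)) k) (power_trace (2 * (1 + u)) k) /\
  conj_pair u (power_trace (2 * (1 + u^-1)) k.+1) (power_trace (2 * (1 + u)) k.+1) by [].
elim: k => [|k [IH0 IH1]]; first by [].
by split=> //; rewrite !power_traceSS; apply: conj_pairB => //; exact: (conj_pairM qu).
Qed.

(** A rational is its own conjugate, whereas power traces increase strictly from 2 on and u >
    1/u. *)
Lemma power_trace_irrational k (a : rat) : power_trace (2 * (1 + u^-1)) k.+1 <> ratr a.
Proof.
move=> e; have := conj_pair_power_trace k.+1; rewrite e => h.
have := conj_pair_fun qu h (conj_pair_rat u a); rewrite -e => /eqP.
rewrite gt_eqF//; apply: power_trace_lt.
  by rewrite mulrDr mulr1 lerDl mulr_ge0// invr_ge0 (le_trans _ u1).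
rewrite ltr_pM2l// ltrD2l.
have lu := unit_lt qu; have : u^-1 < 1 by rewrite invf_lt1// (lt_trans _ lu).
by move=> h'; apply: lt_trans lu.
Qed.

(** Conjugation keeps the trace, which would lie in both Q(u) and Q(u') and so be rational. *)
Lemma hyperbolic_power_conjugate k (g : 'M[R]_2) : \det g = 1 ->
  ~ conjugate g (tiling_group u') (hyperbolic ^+ k.+1).
Proof.
move=> g1 [h Gh hE].
have ug : g \is a GRing.unit by rewrite unitmxE g1 unitr1.
have : \tr (hyperbolic ^+ k.+1) = \tr h.
  rewrite -hE -[_ * _ * _]/((g * h) *m g^-1) mxtrace_mulC.
  by rewrite -[_ *m _]/(g^-1 * (g * h)) mulKr.
rewrite mxtrace_exp ?det_hyperbolic// tr_hyperbolic => trE.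
have [y [a [b [tE _]]]] : quadratic_field u' (\tr h).
  apply: unit_order_field; rewrite tr_mx2E.
  by apply: unit_orderD; exact: (tiling_group_order qu' Gh).
have [a' [b' [pE _]]] := conj_pair_power_trace k.+1.
have b0 : b' = 0 by apply: (@indep a' b' a b); rewrite -pE trE.
by apply: (@power_trace_irrational k a'); rewrite pE b0 rmorph0 mul0r addr0.
Qed.

Lemma tiling_group_not_commensurable :
  ~ commensurable (tiling_group u) (tiling_group u').
Proof.
move=> [g [g1 [_ fin] _]].
have [GS G1 GN GM GV] := tiling_group_psl2 u1.
have [GS' G1' GN' GM' GV'] := tiling_group_psl2 u1'.
have ug : g \is a GRing.unit by rewrite unitmxE g1 unitr1.
pose H := tiling_group u `&` conjugate g (tiling_group u').
have H1 : H 1 by split=> //; exists 1 => //; rewrite mulr1 divrr.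
pose c (i : nat) : set 'M[R]_2 := [set hyperbolic ^+ i * h | h in H].
have Gpow i : tiling_group u (hyperbolic ^+ i).
  elim: i => [|i IH]; first by rewrite expr0.
  by rewrite exprS; apply: GM => //; exact: hyperbolic_in.
have uh i : hyperbolic ^+ i \is a GRing.unit.
  by rewrite unitrX// unitmxE det_hyperbolic unitr1.
(* If two of these cosets agreed, a positive power of [hyperbolic] would lie in the intersection; so
   there are infinitely many cosets. *)
have cinj : injective c.
  have lt_neq i j : (i < j)%N -> c i <> c j.
    move=> ij cij; have : c j (hyperbolic ^+ j) by exists 1; rewrite ?mulr1.
    rewrite -cij => -[h [_ Hh]] /eqP.
    rewrite -(subnKC (ltnW ij)) exprD (inj_eq (mulrI (uh i))) => /eqP hE.
    move: Hh; rewrite hE; move: (subn_gt0 i j); rewrite ij; case: (j - i)%N => [|k _] //.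
    exact: hyperbolic_power_conjugate.
  move=> i j cij; have [ij|ji|//] := ltngtP i j; first by case: (lt_neq _ _ ij).
  by case: (lt_neq _ _ ji).
apply: infinite_nat.
have : finite_set (range c) by apply: sub_finite_set fin => _ [i _ <-]; exists (hyperbolic ^+ i).
by apply: contraPP; rewrite -(eq_finite_set (inj_card_eq (in2W cinj))).
Qed.

End Commensurability.

(** * Irrationality and independence of square roots *)

Lemma rat_sqr_neq (q N : nat) (x : rat) : odd (logn q N) -> x ^+ 2 <> N%:R.
Proof.
move=> oN xN; have N0 : (0 < N)%N by case: N oN {xN}; rewrite ?logn0.
have : numq x ^+ 2 = N%:Z * denq x ^+ 2.
  apply: (@intr_inj rat); rewrite !(rmorphXn, rmorphM) /= -pmulrn -xN -{2}[x]divq_num_den.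
  by rewrite exprMn exprVn divfK// expf_neq0// intr_eq0 denq_neq0.
move=> /(congr1 absz); rewrite !(abszM, abszX) /= => e.
have d0 : (0 < absz (denq x))%N by rewrite absz_gt0 denq_neq0.
have n0 : (0 < absz (numq x))%N.
  by move: e; case: (absz (numq x)) => // /esym /eqP; rewrite exp0n// muln_eq0 expn_eq0 !gtn_eqF.
(* Squares of the numerator and the denominator have even valuation, N an odd one. *)
move/(congr1 (logn q)): e; rewrite lognM ?expn_gt0 ?d0// !lognX => /(congr1 odd).
by rewrite oddD !oddM /= oN.
Qed.

Section QuadraticSurds.
Context {R : realType}.
Implicit Types (D q : nat) (a b : rat).

Lemma sqrt_irrational D q a b : odd (logn q D) ->
  ratr a + ratr b * Num.sqrt (D%:R : R) = 0 -> b = 0.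
Proof.
move=> oD e; apply/eqP/negPn/negP => b0.
apply: (@rat_sqr_neq q D (a / b) oD); apply: (fmorph_inj (ratr : rat -> R)).
rewrite rmorph_nat -[RHS]sqr_sqrtr// rmorphXn fmorph_div /=.
have b0' : (ratr b : R) != 0 by rewrite fmorph_eq0.
have -> : ratr a = - ratr b * Num.sqrt (D%:R : R) by rewrite mulNr; lra.
by field.
Qed.

Lemma sqrt_independent D D' q r s a b a' b' : odd (logn q D) -> odd (logn r D') ->
  odd (logn s (D * D')) ->
  ratr a + ratr b * Num.sqrt (D%:R : R) = ratr a' + ratr b' * Num.sqrt (D'%:R : R) ->
  b = 0.
Proof.
move=> oD oD' oDD e; apply/eqP/negPn/negP => b0.
have b0' : (ratr b : R) != 0 by rewrite fmorph_eq0.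
have := sqr_sqrtr (ler0n R D); have := sqr_sqrtr (ler0n R D').
move: (Num.sqrt (D%:R : R)) (Num.sqrt (D'%:R : R)) (@sqrt_irrational D q) e.
move=> x y irr e yE xE.
(* Squaring c + b x = b' y leaves the rational multiple 2 c b of x, so c = 0; then b x = b' y makes
   D D' the square of b' D'/b. *)
pose c := a - a'.
have e1 : ratr (c ^+ 2 + b ^+ 2 * D%:R - b' ^+ 2 * D'%:R) + ratr (2 * c * b) * x = 0.
  rewrite !(rmorphB, rmorphD, rmorphM, rmorphXn) /= rmorph1 !ratr_nat -xE -yE.
  have -> : ratr a = ratr a' + ratr b' * y - ratr b * x by rewrite -e; ring.
  by ring.
have c0 : c = 0.
  have /eqP := irr _ _ oD e1.
  by rewrite !mulf_eq0 (negbTE b0) orbF /= => /eqP.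
apply: (@rat_sqr_neq s (D * D') (b' * D'%:R / b) oDD).
apply: (fmorph_inj (ratr : rat -> R)).
rewrite rmorph_nat natrM rmorphXn fmorph_div rmorphM rmorph_nat /=.
have e2 : ratr b * x = ratr b' * y.
  have aa : a = a' by apply/eqP; rewrite -subr_eq0 -/c c0.
  by move: e; rewrite aa => /addrI.
rewrite exprMn exprVn -xE -yE.
have -> : (ratr b' * y ^+ 2) ^+ 2 = (ratr b' * y) ^+ 2 * y ^+ 2 :> R by ring.
by rewrite -e2; field.
Qed.

(* The discriminant (p - 2)^2 - 4 of x^2 - (p - 2) x + 1: its p-adic valuation is 1,
   and larger primes do not divide it. *)
Definition prime_disc (p : nat) : nat := (p * (p - 4))%N.

Lemma logn_not_dvd p n : ~~ (p %| n)%N -> logn p n = 0%N.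
Proof. by move=> pn; rewrite lognE (negbTE pn) !andbF. Qed.

Lemma logn_prime_disc p : prime p -> (4 < p)%N -> logn p (prime_disc p) = 1%N.
Proof.
move=> pp p4; rewrite lognM; [|exact: prime_gt0|by rewrite subn_gt0].
rewrite (logn_prime p pp) eqxx.
by rewrite logn_not_dvd// gtnNdvd ?subn_gt0//; lia.
Qed.

Lemma logn_prime_disc_lt p q : prime q -> (4 < p)%N -> (p < q)%N ->
  logn q (prime_disc p) = 0%N.
Proof.
move=> qp p4 pq; rewrite lognM ?subn_gt0//; last by lia.
rewrite !logn_not_dvd// gtnNdvd//; lia.
Qed.

Definition prime_unit (p : nat) : R :=
  ((p - 2)%:R + Num.sqrt (prime_disc p)%:R) / 2.

Lemma prime_unit_ge p : (p - 2)%:R / 2 <= prime_unit p.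
Proof. by rewrite /prime_unit ler_pM2r// lerDl sqrtr_ge0. Qed.

Lemma prime_unit_coord p a b : ratr a + ratr b * prime_unit p =
  ratr (a + b * (p - 2)%:R / 2) + ratr (b / 2) * Num.sqrt ((prime_disc p)%:R : R).
Proof.
rewrite rmorphD !fmorph_div rmorphM /= !ratr_nat /prime_unit; ring.
Qed.

Lemma prime_unit_quadratic p : prime p -> (4 < p)%N ->
  quadratic_unit (p - 2) (prime_unit p).
Proof.
move=> pp p4; split.
- apply: le_trans (prime_unit_ge p); rewrite ler_pdivlMr// mul1r (ler_nat R 2).
  lia.
- have s2 : Num.sqrt ((prime_disc p)%:R : R) ^+ 2 = (p - 2)%:R ^+ 2 - 4.
    rewrite sqr_sqrtr// /prime_disc -natrX; apply/eqP.
    rewrite eq_sym subr_eq -natrD eqr_nat; apply/eqP.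
    have [k ->] : exists k, p = (k + 4)%N by exists (p - 4)%N; lia.
    by rewrite addnK -(addnBA k (isT : 2 <= 4)%N) -mulnn; nia.
  rewrite /prime_unit; set s := Num.sqrt _ in s2 *; set m := (p - 2)%:R in s2 *.
  transitivity ((m ^+ 2 + 2 * m * s + s ^+ 2) / 4); first by field.
  by rewrite s2; field.
- move=> a b; rewrite prime_unit_coord => /sqrt_irrational => /(_ p).
  rewrite logn_prime_disc// => /(_ isT) /eqP.
  by rewrite mulf_eq0 invr_eq0 orbF => /eqP.
Qed.

Lemma prime_unit_independent p q : prime p -> prime q -> (4 < p)%N -> (4 < q)%N -> p <> q ->
  forall a b a' b' : rat,
  ratr a + ratr b * prime_unit p = ratr a' + ratr b' * prime_unit q -> b = 0.
Proof.
move=> pp qp p4 q4 pq a b a' b'; rewrite !prime_unit_coord => e.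
have pos n : (4 < n)%N -> (0 < prime_disc n)%N by move=> n4; rewrite muln_gt0 subn_gt0; lia.
(* At the larger prime one discriminant has valuation 1 and the other 0. *)
have [s os] : exists s, odd (logn s (prime_disc p * prime_disc q)).
  have [pltq|qltp|//] := ltngtP p q; [exists q|exists p]; rewrite lognM ?pos//.
    by rewrite logn_prime_disc// logn_prime_disc_lt.
  by rewrite logn_prime_disc// logn_prime_disc_lt.
have op : odd (logn p (prime_disc p)) by rewrite logn_prime_disc.
have oq : odd (logn q (prime_disc q)) by rewrite logn_prime_disc.
have /eqP := sqrt_independent op oq os e.
by rewrite mulf_eq0 invr_eq0 orbF => /eqP.
Qed.

End QuadraticSurds.

(** * Stretch *)

Section Displacement.
Context {R : realType}.
Implicit Types (g : 'M[R]_2) (z : R[i]) (s t : R).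
Notation Re := complex.Re.
Notation Im := complex.Im.

(** The squared expression c |z|^2 + (d - a) Re z - b vanishes on the axis when g is hyperbolic. The
    other term depends on the trace alone and gives the least displacement, whose cosh is tr^2/2 -
    1. *)
Lemma hyp_dist_mobius g z : \det g = 1 -> 0 < Im z ->
  hyp_dist z (mobius g z) =
  arcosh (1 + ((g 1 0 * (Re z ^+ 2 + Im z ^+ 2) + (g 1 1 - g 0 0) * Re z - g 0 1) ^+ 2 +
     Im z ^+ 2 * (\tr g ^+ 2 - 4)) / (2 * Im z ^+ 2)).
Proof.
move=> dg z0; have := mobius_den_gt0 dg z0.
rewrite /hyp_dist mobius_reim// tr_mx2E /=.
move: dg; rewrite det_mx2E /mobius_den; case: z z0 => x y /= y0.
move: (g 0 0) (g 0 1) (g 1 0) (g 1 1) => a b c d dg n0.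
congr (arcosh (1 + _)).
set n := (c * x + d) ^+ 2 + (c * y) ^+ 2 in n0 *.
set r := (a * x + b) * (c * x + d) + a * c * y ^+ 2.
(* With ad - bc in place of 1 the identity holds for arbitrary entries. *)
have key : (x * n - r) ^+ 2 + y ^+ 2 * (n - (a * d - b * c)) ^+ 2 =
    n * ((c * (x ^+ 2 + y ^+ 2) + (d - a) * x - b) ^+ 2 +
         y ^+ 2 * ((a + d) ^+ 2 - 4 * (a * d - b * c))).
  by rewrite /n /r; ring.
move: key; rewrite dg mulr1; set q := _ + _ * (_ - 4) => key.
have nn := lt0r_neq0 n0; have yn := lt0r_neq0 y0.
transitivity (((x * n - r) ^+ 2 + y ^+ 2 * (n - 1) ^+ 2) / (n * (2 * y ^+ 2))).
  by field; rewrite yn nn.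
by rewrite key; field; rewrite yn nn.
Qed.

Lemma arcosh_le s t : 1 <= s -> s <= t -> arcosh s <= arcosh t.
Proof.
move=> s1 st; have t1 := le_trans s1 st.
have s0 : 0 < s by apply: lt_le_trans s1.
have t0 : 0 < t by apply: lt_le_trans t1.
rewrite /arcosh ler_ln ?posrE ?ltr_wpDr ?sqrtr_ge0//.
apply: lerD => //; apply: ler_wsqrtr; rewrite lerD2r.
by apply: ler_sqr2 => //; exact: ltW.
Qed.

Lemma ln_le_arcosh t : 1 <= t -> ln t <= arcosh t.
Proof.
move=> t1; have t0 : 0 < t by apply: lt_le_trans t1.
by rewrite /arcosh ler_ln ?posrE ?ltr_wpDr ?sqrtr_ge0// lerDl sqrtr_ge0.
Qed.

Lemma displacement_ge g z : \det g = 1 -> 0 < Im z -> 4 <= \tr g ^+ 2 ->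
  ln (\tr g ^+ 2 / 2 - 1) <= hyp_dist z (mobius g z).
Proof.
move=> dg z0 tr4; rewrite hyp_dist_mobius//.
apply: (@le_trans _ _ (arcosh (\tr g ^+ 2 / 2 - 1))); first by apply: ln_le_arcosh; lra.
apply: arcosh_le; first by lra.
rewrite mulrDl -[X in _ <= _ + (_ + X)](_ : (\tr g ^+ 2 - 4) / 2 = _); last first.
  by field; rewrite lt0r_neq0.
have : 0 <= (g 1 0 * (Re z ^+ 2 + Im z ^+ 2) + (g 1 1 - g 0 0) * Re z - g 0 1) ^+ 2
     / (2 * Im z ^+ 2).
  by rewrite divr_ge0 ?sqr_ge0// mulr_ge0// sqr_ge0.
by lra.
Qed.

Lemma displacement_axis g z : \det g = 1 -> 0 < Im z ->
  g 1 0 * (Re z ^+ 2 + Im z ^+ 2) + (g 1 1 - g 0 0) * Re z - g 0 1 = 0 ->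
  hyp_dist z (mobius g z) = arcosh (\tr g ^+ 2 / 2 - 1).
Proof.
move=> dg z0 ax; rewrite hyp_dist_mobius// ax expr0n add0r; congr arcosh.
by field; rewrite lt0r_neq0.
Qed.

End Displacement.

Section Stretch.
Context {R : realType}.
Variables (m : nat) (u : R).
Hypothesis qu : quadratic_unit m u.
Let u1 : 1 <= u := let: And3 h _ _ := qu in h.
Let u0 : u != 0 := unit_neq0 qu.
Local Notation G := (tiling_group u).
Local Notation K := (inv_trace_field G).
Local Notation A := (inv_quat_algebra G).

(** Applying rho to g^2 = k g - 1 and subtracting Cayley-Hamilton for rho(g) leaves (f(k) - tr)
    rho(g) scalar. If the trace were not f(k), rho(g) would be scalar, so by injectivity g would
    commute with an upper matrix unit, against its nonzero lower entry. *)
Lemma embedding_char (f : {rmorphism K -> R}) (rho : {rmorphism A -> 'M[R]_2})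
    (k : K) (g : A) :
  injective rho -> @extends R G f rho -> \det (val g) = 1 -> val g 1 0 != 0 ->
  val k = \tr (val g) -> \det (rho g) = 1 /\ \tr (rho g) = f k.
Proof.
move=> inj ext g1 gc kE.
have in01 : mx2 0 1 0 0 \in quat_algebra G.
  apply/(quat_algebraP qu) => i j; rewrite mxE.
  by case: ifP => _; case: ifP => _; rewrite ?rpred0 ?rpred1.
have ink : (val k)%:M \in quat_algebra G.
  apply/(quat_algebraP qu) => i j; rewrite mxE rpredMn//; exact: valP.
pose e : A := Sub (mx2 0 1 0 0) in01.
pose c : A := Sub (val k)%:M ink.
have gg : g * g = c * g - 1.
  apply: val_inj; rewrite [RHS]/= -[LHS]/(val g ^+ 2) sqr_mx2 g1 -kE.
  by rewrite -mul_scalar_mx.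
have := congr1 rho gg; rewrite rmorphM rmorphB rmorphM rmorph1.
rewrite (ext k c erefl) -[rho g * rho g]/(rho g ^+ 2) sqr_mx2.
rewrite -[_%:M * _]/(_%:M *m _) mul_scalar_mx => XE.
have XE' : (f k - \tr (rho g)) *: rho g = (1 - \det (rho g))%:M.
  move/eqP: XE; rewrite eq_sym subr_eq => /eqP XE.
  by rewrite scalerBl XE addrAC [X in X + 1]addrAC subrr add0r addrC raddfB.
have fkE : f k = \tr (rho g).
  apply/eqP/negPn/negP; rewrite -subr_eq0 => fk0.
  pose r := (f k - \tr (rho g))^-1 * (1 - \det (rho g)).
  have XS : rho g = r%:M.
    by rewrite -[LHS]scale1r -(mulVf fk0) -scalerA XE' scale_scalar_mx.
  have ge : g * e = e * g.
    apply: inj; rewrite !rmorphM XS.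
    by rewrite -[LHS]/(_%:M *m _) -[RHS]/(_ *m _%:M) scalar_mxC.
  have : (val g * mx2 0 1 0 0) 0 0 = (mx2 0 1 0 0 * val g) 0 0.
    exact: (congr1 (fun x : A => val x 0 0) ge).
  by rewrite !mulmx2 !mx2E !mulr0 mul0r mul1r !add0r => /esym/eqP; apply/negP.
split=> //; move: XE'; rewrite fkE subrr scale0r => /matrixP/(_ 0 0).
by rewrite !mxE mulr1n => /esym/eqP; rewrite subr_eq0 => /eqP.
Qed.

Definition axis_square : 'M[R]_2 := hyperbolic u ^+ 2.

(** The top of the axis of [hyperbolic], a semicircle whose ends are the roots of x^2 - 2(u + 1) x +
    u^2. *)
Definition axis_point : R[i] := ((u + 1) +i* Num.sqrt (2 * u + 1))%C.

Lemma axis_squareE : axis_square = mx2 (4 * (u + 1) ^+ 2 / u ^+ 2 - 1) (- (2 * (u + 1)))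
  (2 * (u + 1) / u ^+ 2) (- 1).
Proof.
rewrite /axis_square (hyperbolicE qu) expr2 mulmx2.
by apply: mx2P; rewrite !mx2E; field.
Qed.

Lemma axis_point_upper : 0 < complex.Im axis_point.
Proof. by rewrite /= sqrtr_gt0; have := u1; lra. Qed.

Lemma det_axis_square : \det axis_square = 1.
Proof. by rewrite /axis_square expr2 det_mx2M (det_hyperbolic qu) mulr1. Qed.

Lemma tr_axis_square : \tr axis_square = (2 * (1 + u^-1)) ^+ 2 - 2.
Proof.
rewrite /axis_square sqr_mx2 (det_hyperbolic qu) (tr_hyperbolic qu) raddfB /=.
by rewrite mxtraceZ mxtrace1 (tr_hyperbolic qu) expr2.
Qed.

(** As 1/u is at most 1, the trace of the square is at most 4^2 - 2 = 14, and 97 = 14^2/2 - 1. *)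
Lemma axis_displacement :
  0 <= hyp_dist axis_point (mobius axis_square axis_point) <= arcosh 97.
Proof.
rewrite displacement_axis ?det_axis_square ?axis_point_upper//; last first.
  rewrite axis_squareE !mx2E /= sqr_sqrtr; last by have := u1; lra.
  by field.
have v1 : u^-1 <= 1 by rewrite invf_le1// (lt_le_trans _ u1).
have v0 : 0 < u^-1 by rewrite invr_gt0 (lt_le_trans _ u1).
rewrite tr_axis_square; set t := _ ^+ 2 - 2.
have t2 : 2 <= t by rewrite /t; nra.
have t14 : t <= 14 by rewrite /t; nra.
have s1 : 1 <= t ^+ 2 / 2 - 1 by nra.
apply/andP; split; last by apply: arcosh_le; nra.
by apply: le_trans (ln_le_arcosh s1); exact: ln_ge0.
Qed.

Lemma axis_square_in : squares_subgroup G axis_square.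
Proof. by apply: squares_subgroup_sqr; exact: (hyperbolic_in qu). Qed.

Lemma stretch_lower_bound L : has_stretch_at_most G L -> ln u <= L * arcosh 97.
Proof.
move=> [n [f [rho [k [phi [[finj frange f0 rho0 frho] kL [phiU lip] equiv]]]]]].
have [i _ fi] : range f (conj_embedding qu).
  by rewrite frange; exact: (all_split qu).
have [rhoi exti] := frho i; rewrite fi in exti.
have gA : axis_square \in quat_algebra G.
  apply/(quat_algebraP qu) => a b; apply/(trace_fieldP qu)/unit_order_field.
  by apply: (tiling_group_order qu); apply: (squares_subgroup_sub qu); exact: axis_square_in.
pose g : A := Sub axis_square gA.
have trK : \tr (val g) \in trace_field G.
  by apply/mem_set => S [_]; apply; exists axis_square => //; exact: axis_square_in.
pose kt : K := Sub (\tr (val g)) trK.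
have uv : 0 < u by apply: lt_le_trans u1.
have gc : val g 1 0 != 0.
  by rewrite /= axis_squareE mx2E mulf_neq0 ?invr_neq0 ?expf_neq0// mulf_neq0// lt0r_neq0// addr_gt0.
have [dX tX] := embedding_char rhoi exti (det_axis_square : \det (val g) = 1) gc (erefl : val kt = _).
have ktE : conj_embedding qu kt = (2 * (1 + u)) ^+ 2 - 2.
  apply: (@conj_embeddingP _ _ _ qu (\tr axis_square)); first by [].
  have := conj_pair_power_trace qu 2; rewrite /= tr_axis_square -!expr2; exact.
rewrite ktE in tX.
have z0 := axis_point_upper.
have lipz := lip _ _ z0 (mobius_upper det_axis_square z0).
have ez : phi (mobius axis_square axis_point) i = mobius (rho i g) (phi axis_point i).
  exact: (equiv g axis_square_in).
(* The maximum over the factors dominates the conjugate one, where the trace is (2(1 + u))^2 - 2. *)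
have low : ln u <= kobayashi_dist (phi axis_point) (phi (mobius axis_square axis_point)).
  apply: (@le_trans _ _ (hyp_dist (phi axis_point i) (phi (mobius axis_square axis_point) i))).
    rewrite ez; apply: le_trans (displacement_ge dX (phiU _ z0 i) _); rewrite tX; last first.
      by have := u1; nra.
    rewrite ler_ln ?posrE//; last by have := u1; nra.
    by have := u1; nra.
  exact: (le_bigmax _ (fun j => hyp_dist (phi axis_point j) _)).
have := le_trans low lipz.
have /andP[d0 d97] := axis_displacement.
move: d0 d97; set d := hyp_dist _ _ => d0 d97 lnd.
have lnu : 0 < ln u by rewrite ln_gt0// (unit_lt qu).
(* The sign is needed to multiply the bound on [d] by [k]; it follows from ln u > 0. *)
have k0 : 0 <= k.
  rewrite leNgt; apply/negP => k0.
  have : k * d <= 0 by rewrite mulr_le0_ge0// ltW.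
  by rewrite leNgt (lt_le_trans lnu lnd).
apply: (le_trans lnd); apply: (@le_trans _ _ (k * arcosh 97)); first exact: ler_wpM2l.
by apply: ler_wpM2r => //; exact: le_trans d97.
Qed.

End Stretch.

(** * The family indexed by primes *)

Fixpoint prime_seq (n : nat) : nat :=
  if n is n'.+1 then s2val (prime_above (prime_seq n')) else 5.

Lemma prime_seq_prime n : prime (prime_seq n).
Proof. by case: n => [//|n] /=; exact: (s2valP' (prime_above (prime_seq n))). Qed.

Lemma prime_seq_lt n : (prime_seq n < prime_seq n.+1)%N.
Proof. exact: (s2valP (prime_above (prime_seq n))). Qed.

Lemma prime_seq_ge n : (n + 5 <= prime_seq n)%N.
Proof. by elim: n => // n IH; rewrite addSn (leq_ltn_trans IH)// prime_seq_lt. Qed.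

Lemma prime_seq_gt4 n : (4 < prime_seq n)%N.
Proof. by apply: leq_trans (prime_seq_ge n); rewrite leq_addl. Qed.

Lemma prime_seq_inj : injective prime_seq.
Proof.
have mono : {homo prime_seq : i j / (i < j)%N}.
  by apply: homo_ltn => [i j k|i]; [exact: ltn_trans|exact: prime_seq_lt].
move=> i j ij; have [/mono|/mono|//] := ltngtP i j; by rewrite ij ltnn.
Qed.

Theorem mainTheorem4 (R : realType) :
  exists F : set (set 'M[R]_2),
  [/\ infinite_set F,
      forall G, F G -> semi_arithmetic G,
      forall G1 G2, F G1 -> F G2 -> G1 <> G2 -> ~ commensurable G1 G2,
      exists (a : R) (r : nat),
        forall G, F G -> has_coarea G a%:E /\ has_arith_dim G r &
      forall M : R, exists2 G, F G & (M%:E < stretch G)%E].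
Proof.
pose u n : R := prime_unit (prime_seq n).
have qu n : quadratic_unit (prime_seq n - 2) (u n).
  exact: prime_unit_quadratic (prime_seq_prime n) (prime_seq_gt4 n).
have u1 n : 1 <= u n by have [] := qu n.
have indep i j : i <> j -> forall a b a' b' : rat,
    ratr a + ratr b * u i = ratr a' + ratr b' * u j -> b = 0.
  move=> ij; apply: prime_unit_independent; rewrite ?prime_seq_prime ?prime_seq_gt4//.
  by move=> /prime_seq_inj.
pose G n := tiling_group (u n).
exists (range G); split.
(* The first power of [hyperbolic], conjugated by 1, already tells the groups apart. *)
- have Ginj : injective G.
    move=> i j Gij; apply/eqP/negPn/negP => /eqP ij.
    apply: (@hyperbolic_power_conjugate _ _ _ _ _ (qu i) (qu j) (indep i j ij) 0 1).
      by rewrite det1.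
    exists (hyperbolic (u i)); last by rewrite mul1r invr1 mulr1 expr1.
    by rewrite -/(G j) -Gij; exact: (hyperbolic_in (qu i)).
  move=> fin; apply: infinite_nat; move: fin.
  by rewrite (eq_finite_set (inj_card_eq (in2W Ginj))).
- move=> _ [n _ <-]; split.
  + exact: tiling_group_fuchsian.
  + by eexists; exact: tiling_group_coarea.
  + exact: (inv_trace_field_number_field (qu n)).
  + exact: (inv_trace_field_totally_real (qu n)).
  + move=> g Gg; apply: (unit_order_integral (qu n)); rewrite tr_mx2E.
    by apply: unit_orderD; exact: (tiling_group_order (qu n) Gg).
- move=> _ _ [i _ <-] [j _ <-] Gij.
  apply: (tiling_group_not_commensurable (qu i) (qu j)); apply: indep.
  by move=> ij; apply: Gij; rewrite ij.
- exists (fine (@ideal_triangle_area R) + fine (@ideal_triangle_area R)), 2%N.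
  move=> _ [n _ <-]; split; first exact: tiling_group_coarea.
  exact: (arith_dim_two (qu n)).
- move=> M; pose C : R := arcosh 97.
  have C0 : 0 < C by apply: lt_le_trans (ln_le_arcosh _); rewrite ?ln_gt0//; lra.
  (* The prime of index N + 1 is at least N + 6, so u is at least (N + 1)/2, which exceeds exp((M +
     1) C). *)
  pose N := Num.truncn (2 * expR ((M + 1) * C)).
  exists (G N.+1); first by exists N.+1.
  (* An infimum inherits only weak inequalities, so M + 1 is bounded in order to exceed M
     strictly. *)
  apply: (@lt_le_trans _ _ (M + 1)%:E); first by rewrite lte_fin ltrDl.
  apply: le_ereal_inf_tmp => _ [L /= /(stretch_lower_bound (qu _)) lnL <-].
  rewrite lee_fin -(ler_pM2r C0); apply: le_trans lnL.
  rewrite -[leLHS]expRK ler_ln ?posrE ?expR_gt0//; last by apply: lt_le_trans (u1 _).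
  apply: le_trans (prime_unit_ge _); rewrite ler_pdivlMr// mulrC.
  apply: (@le_trans _ _ N.+1%:R); first exact/ltW/truncnS_gt.
  by rewrite ler_nat; have := prime_seq_ge N.+1; lia.
Qed.
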